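(* Let $\vec p=(p_1,\infty)$ with $1<p_1<\infty$, and let $\vec a,\vec b,\vec c\in\mathbb{R}^2$, $\vec\alpha\in(-1,\infty)^2$. Then the following are equivalent: (1) $S_{\vec a,\vec b,\vec c}$ is bounded from $L^{\vec p}_{\vec\alpha}(T_B\times T_B)$ to $L^\infty(T_B\times T_B)$; (2) $T_{\vec a,\vec b,\vec c}$ is bounded from $L^{\vec p}_{\vec\alpha}(T_B\times T_B)$ to $L^\infty(T_B\times T_B)$; (3) $a_1>0$, $a_2>0$, $p_1(b_1+1)>\alpha_1+1$, $b_2>-1$, $c_1=n+1+a_1+b_1-\frac{n+1+\alpha_1}{p_1}$, and $c_2=n+1+a_2+b_2$.
   Context: Let $n$ be a positive integer. For $z=(z_1,\dots,z_n)\in\mathbb{C}^n$ write $z=x+iy$ with $x,y\in\mathbb{R}^n$, $z'=(z_1,\dots,z_{n-1})$, $y'=(y_1,\dots,y_{n-1})$. Let $B=\{y\in\mathbb{R}^n: |y'|^2<y_n\}$ and $T_B=\{x+iy: x\in\mathbb{R}^n, y\in B\}$. For $z\in T_B$ put $\rho(z)=y_n-|y'|^2>0$, and for $z,u\in T_B$ put $\rho(z,u)=\frac14\big(\sum_{j=1}^{n-1}(z_j-\overline{u_j})^2-2i(z_n-\overline{u_n})\big)$; this has positive real part, and complex powers $\rho(z,u)^c$ are taken with the principal branch. $dV$ is Lebesgue measure on $\mathbb{C}^n$ and $dV_\alpha(z)=\rho(z)^\alpha dV(z)$. For $\vec p=(p_1,p_2)\in[1,\infty]^2$ and $\vec\alpha=(\alpha_1,\alpha_2)$,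 $L^{\vec p}_{\vec\alpha}(T_B\times T_B)$ is the space of measurable $f$ on $T_B\times T_B$ with finite mixed norm $\|f\|_{\vec p,\vec\alpha}=\big\{\int_{T_B}\big(\int_{T_B}|f(z,w)|^{p_1}dV_{\alpha_1}(z)\big)^{p_2/p_1}dV_{\alpha_2}(w)\big\}^{1/p_2}$, with the inner (resp. outer) integral replaced by an essential supremum in $z$ (resp. $w$) when $p_1=\infty$ (resp. $p_2=\infty$); when $\vec p=(\infty,\infty)$ this is $L^\infty(T_B\times T_B)$. For $\vec a=(a_1,a_2),\vec b=(b_1,b_2),\vec c=(c_1,c_2)\in\mathbb{R}^2$, $T_{\vec a,\vec b,\vec c}f(z,w)=\rho(z)^{a_1}\rho(w)^{a_2}\int_{T_B}\int_{T_B}\frac{\rho(u)^{b_1}\rho(\eta)^{b_2}}{\rho(z,u)^{c_1}\rho(w,\eta)^{c_2}}f(u,\eta)\,dV(u)\,dV(\eta)$ and $S_{\vec a,\vec b,\vec c}f(z,w)=\rho(z)^{a_1}\rho(w)^{a_2}\int_{T_B}\int_{T_B}\frac{\rho(u)^{b_1}\rho(\eta)^{b_2}}{|\rho(z,u)|^{c_1}|\rho(w,\eta)|^{c_2}}f(u,\eta)\,dV(u)\,dV(\eta)$. An operator is bounded from $X$ to $Y$ if for every $f\in X$ the defining integral converges for a.e. $(z,w)$ and $\|Tf\|_Y\le C\|f\|_X$ with $C$ independent of $f$. *)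

(* Defs.v *)
From HB Require Import structures.
From mathcomp Require Import all_boot all_order all_algebra.
From mathcomp Require Import all_classical all_reals all_analysis.
From mathcomp Require Import complex.

Set Implicit Arguments.
Unset Strict Implicit.
Unset Printing Implicit Defensive.

Import Order.TTheory GRing.Theory Num.Theory.
Import numFieldNormedType.Exports.

Local Open Scope classical_set_scope.
Local Open Scope ring_scope.

(* The space C^k with Lebesgue measure, as an iterated product              *)
(*   C^0 = unit,  C^(k+1) = (R * R) * C^k ,                                 *)
(* where a complex coordinate x + i y is the pair (x, y) : R * R.           *)

(* product of two sigma-finite measures, packaged as a sigma-finite measure
   (the library's instance is shadowed by a more specific one) *)
Section pm.
Local Open Scope ereal_scope.
Context d1 d2 (T1 : measurableType d1) (T2 : measurableType d2) (R : realType).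
Variable m1 : {sigma_finite_measure set T1 -> \bar R}.
Variable m2 : {sigma_finite_measure set T2 -> \bar R}.
Definition pmeasure := (m1 \x m2)%E.
HB.instance Definition _ := Measure.on pmeasure.
Lemma pmeasure_sigma_finite : sigma_finite setT pmeasure.
Proof.
have /sigma_finiteP[F [TF ndF Foo]] := sigma_finiteT m1.
have /sigma_finiteP[G [TG ndG Goo]] := sigma_finiteT m2.
exists (fun n => F n `*` G n).
 rewrite -setXTT TF TG predeqE => -[x y]; split.
    move=> [/= [n _ Fnx] [k _ Gky]]; exists (maxn n k) => //; split.
    - by move: x Fnx; exact/subsetPset/ndF/leq_maxl.
    - by move: y Gky; exact/subsetPset/ndG/leq_maxr.
  by move=> [n _ []/= ? ?]; split; exists n.
move=> k; have [? ?] := Foo k; have [? ?] := Goo k.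
split; first exact: measurableX.
by rewrite /pmeasure product_measure1E// lte_mul_pinfty// ge0_fin_numE.
Qed.
HB.instance Definition _ := Measure_isSigmaFinite.Build _ _ _ pmeasure pmeasure_sigma_finite.
End pm.
Arguments pmeasure {d1 d2 T1 T2 R}.
(* Lebesgue measure on R (Borel sets) *)
Definition lebR (R : realType) : {sigma_finite_measure set (measurableTypeR R) -> \bar R} :=
  SigmaFiniteMeasure.clone _ _ _ (@lebesgue_measure R) _.

Fixpoint Cspace (R : realType) (k : nat) : {d : measure_display & measurableType d} :=
  match k with
  | 0 => existT measurableType _ (unit : measurableType _)
  | k.+1 => existT measurableType _ (((measurableTypeR R * measurableTypeR R) * projT2 (Cspace R k))%type : measurableType _)
  end.

Definition CN (R : realType) (k : nat) : Type := projT2 (Cspace R k).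

Definition leb2 (R : realType) : {sigma_finite_measure set (measurableTypeR R * measurableTypeR R)%type -> \bar R} :=
  SigmaFiniteMeasure.clone _ _ _ (pmeasure (lebR R) (lebR R)) _.

(* Lebesgue measure dV on C^k (= R^(2k)) *)
Fixpoint lebC (R : realType) (k : nat) :
    {sigma_finite_measure set (projT2 (Cspace R k)) -> \bar R} :=
  match k as k return {sigma_finite_measure set (projT2 (Cspace R k)) -> \bar R} with
  | 0 => SigmaFiniteMeasure.clone _ _ _ (@dirac _ unit tt R) _
  | k.+1 => SigmaFiniteMeasure.clone _ _ _ (pmeasure (leb2 R) (lebC R k)) _
  end.

(* j-th complex coordinate (j = 0, ..., k-1) as a pair (Re, Im); 0 beyond *)
Fixpoint coordC (R : realType) (k : nat) : CN R k -> nat -> (R * R)%type :=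
  match k as k return CN R k -> nat -> (R * R)%type with
  | 0 => fun _ _ => (0, 0)
  | k.+1 => fun z j => match j with 0 => z.1 | j.+1 => @coordC R k z.2 j end
  end.

Arguments coordC : clear implicits.
Arguments lebC : clear implicits.
Arguments CN : clear implicits.

Section Tube.
Variables (R : realType) (n : nat).
Local Notation CN := (CN R n).
Local Notation dV := (lebC R n).
Local Open Scope complex_scope.

(* z_j for j = 1..n is  zc z (j-1) *)
Definition zc (z : CN) (j : nat) : R[i] :=
  (coordC R n z j).1 +i* (coordC R n z j).2.

(* rho(z) = y_n - |y'|^2 *)
Definition rho (z : CN) : R :=
  (coordC R n z n.-1).2 - \sum_(j < n.-1) ((coordC R n z j).2) ^+ 2.

(* the tube T_B over the Siegel domain B *)
Definition TB : set CN := [set z | 0 < rho z].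

(* rho(z,u) = 1/4 ( sum_{j<n} (z_j - conj u_j)^2 - 2 i (z_n - conj u_n) ) *)
Definition rho2 (z u : CN) : R[i] :=
  (4%:R)^-1%:C * (\sum_(j < n.-1) (zc z j - (zc u j)^*) ^+ 2
                  - (2%:R)%:C * 'i * (zc z n.-1 - (zc u n.-1)^*)).

End Tube.

Section ComplexAux.
Variable R : realType.
Local Open Scope complex_scope.

Definition cabs (w : R[i]) : R := Num.sqrt (complex.Re w ^+ 2 + complex.Im w ^+ 2).

(* principal argument, in (-pi, pi] *)
Definition carg (w : R[i]) : R :=
  let x := complex.Re w in let y := complex.Im w in
  if 0 < x then atan (y / x)
  else if x < 0 then (if 0 <= y then atan (y / x) + pi else atan (y / x) - pi)
  else if 0 < y then pi / 2 else if y < 0 then - (pi / 2) else 0.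

(* principal branch of w^c = exp (c Log w), for real c and w <> 0 *)
Definition cpow (w : R[i]) (c : R) : R[i] :=
  (cabs w `^ c)%:C * ((cos (c * carg w)) +i* (sin (c * carg w))).

(* complex-valued Lebesgue integral (via real and imaginary parts) *)
Definition cintegrable d (T : measurableType d) (mu : {measure set T -> \bar R})
    (D : set T) (g : T -> R[i]) : Prop :=
  mu.-integrable D (fun x => (complex.Re (g x))%:E) /\
  mu.-integrable D (fun x => (complex.Im (g x))%:E).

Definition cint d (T : measurableType d) (mu : {measure set T -> \bar R})
    (D : set T) (g : T -> R[i]) : R[i] :=
  Rintegral mu D (fun x => complex.Re (g x)) +i* Rintegral mu D (fun x => complex.Im (g x)).

Definition cmeasurable d (T : measurableType d) (g : T -> R[i]) : Prop :=
  measurable_fun setT (fun x => complex.Re (g x)) /\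
  measurable_fun setT (fun x => complex.Im (g x)).

End ComplexAux.

Section Operators.
Variables (R : realType) (n : nat).
Local Notation CN := (CN R n).
Local Notation dV := (lebC R n).
Local Notation rho := (@rho R n).
Local Notation rho2 := (@rho2 R n).
Local Notation TB := (@TB R n).
Local Open Scope complex_scope.

Definition dV2 := pmeasure dV dV.

(* integrand of T_{a,b,c} at (z,w), as a function of (u,eta) *)
Definition Tkernel (b1 b2 c1 c2 : R) (f : CN * CN -> R[i]) (z w : CN)
    (ue : CN * CN) : R[i] :=
  ((rho ue.1 `^ b1) * (rho ue.2 `^ b2))%:C
  / (cpow (rho2 z ue.1) c1 * cpow (rho2 w ue.2) c2) * f ue.

(* integrand of S_{a,b,c} at (z,w) *)
Definition Skernel (b1 b2 c1 c2 : R) (f : CN * CN -> R[i]) (z w : CN)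
    (ue : CN * CN) : R[i] :=
  ((rho ue.1 `^ b1) * (rho ue.2 `^ b2)
   / ((cabs (rho2 z ue.1) `^ c1) * (cabs (rho2 w ue.2) `^ c2)))%:C * f ue.

Definition Top (a1 a2 b1 b2 c1 c2 : R) (f : CN * CN -> R[i]) (zw : CN * CN) : R[i] :=
  ((rho zw.1 `^ a1) * (rho zw.2 `^ a2))%:C *
  cint dV2 (TB `*` TB) (Tkernel b1 b2 c1 c2 f zw.1 zw.2).

Definition Sop (a1 a2 b1 b2 c1 c2 : R) (f : CN * CN -> R[i]) (zw : CN * CN) : R[i] :=
  ((rho zw.1 `^ a1) * (rho zw.2 `^ a2))%:C *
  cint dV2 (TB `*` TB) (Skernel b1 b2 c1 c2 f zw.1 zw.2).

(* w-a.e. on T_B with respect to dV_al(w) = rho(w)^al dV(w) *)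
Definition ae_TB_weighted (al : R) (P : CN -> Prop) : Prop :=
  exists N : set CN, measurable N /\
    (\int[dV]_(w in N `&` TB) (rho w `^ al)%:E = 0)%E /\
    forall w, TB w -> ~ N w -> P w.

(* mixed norm  || f ||_{(p1,oo),(al1,al2)} *)
Definition mixed_norm_p_infty (p1 al1 al2 : R) (f : CN * CN -> R[i]) : \bar R :=
  ereal_inf [set M : \bar R | ae_TB_weighted al2 (fun w =>
     ((\int[dV]_(z in TB) ((cabs (f (z, w)) `^ p1) * rho z `^ al1)%:E) `^ p1^-1
       <= M)%E)].

(* boundedness from L^{(p1,oo)}_{(al1,al2)}(T_B x T_B) to L^oo(T_B x T_B) *)
Definition bounded_to_Linfty (p1 al1 al2 : R)
    (conv : (CN * CN -> R[i]) -> CN * CN -> Prop)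
    (Op : (CN * CN -> R[i]) -> CN * CN -> R[i]) : Prop :=
  exists C : R, forall f : CN * CN -> R[i],
    cmeasurable f -> (mixed_norm_p_infty p1 al1 al2 f < +oo)%E ->
    (\forall zw \ae dV2, (TB `*` TB) zw -> conv f zw) /\
    (\forall zw \ae dV2, (TB `*` TB) zw ->
        ((cabs (Op f zw))%:E <= C%:E * mixed_norm_p_infty p1 al1 al2 f)%E).

Definition T_bounded (p1 al1 al2 a1 a2 b1 b2 c1 c2 : R) : Prop :=
  bounded_to_Linfty p1 al1 al2
    (fun f zw => cintegrable dV2 (TB `*` TB) (Tkernel b1 b2 c1 c2 f zw.1 zw.2))
    (Top a1 a2 b1 b2 c1 c2).

Definition S_bounded (p1 al1 al2 a1 a2 b1 b2 c1 c2 : R) : Prop :=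
  bounded_to_Linfty p1 al1 al2
    (fun f zw => cintegrable dV2 (TB `*` TB) (Skernel b1 b2 c1 c2 f zw.1 zw.2))
    (Sop a1 a2 b1 b2 c1 c2).

End Operators.

(* Main.v *)
Require Import Defs.
From HB Require Import structures.
From mathcomp Require Import all_boot all_order all_algebra.
From mathcomp Require Import all_classical all_reals all_analysis.
From mathcomp Require Import complex.
From mathcomp Require Import measurable_realfun ring lra.

Set Implicit Arguments.
Unset Strict Implicit.
Unset Printing Implicit Defensive.

Import Order.TTheory GRing.Theory Num.Theory.
Import numFieldNormedType.Exports.
Local Open Scope classical_set_scope.
Local Open Scope ring_scope.

(* For z, u in the tube, 4 Re rho(z,u) = 2 rho(z) + 2 rho(u) + q with
   q = |x' - s'|^2 + |y' - t'|^2, so {u : |rho(z,u)| <= l, h < rho(u) <= 2h} lies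
   in a Heisenberg box whose volume is of order l^n h.  Summing over dyadic l and
   h gives the Forelli-Rudin estimate
     int rho(u)^b |rho(z,u)|^-c dV(u) <= C rho(z)^(n+1+b-c),  b > -1, c > n+1+b,
   and with Hoelder's inequality in the first variable this is (3) => (1).
   Since |T f| <= S|f| up to a constant, (1) => (2).  For (2) => (3), indicators
   of products of boxes of heights H1, H2, so thin that the kernel has nearly
   constant argument on them, yield
     H1^(a1+b1-c1+n+1-(n+1+al1)/p1) H2^(a2+b2-c2+n+1) <= C
   for all H1, H2 > 0, hence both exponents vanish.  The four inequalities only
   use the convergence of the defining integral: if one of them fails, a sum of
   indicators of boxes of height 4^j or 4^-j with weights of order 1/(j+1) has
   finite mixed norm but a divergent (harmonic) integral. *)

(** * Recursion on the number of variables *)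

(** Boundedness of [T] is used in two ways. For the equalities the size of [T f] has to be bounded
    below, which is an oscillating integral; hence the thin boxes, on which the real part of the
    kernel keeps at least half of the modulus. For the inequalities only integrability counts; it
    passes to the modulus of the integrand, where the phase disappears, so wide boxes are allowed
    and can be sent to infinity or to the boundary. The imaginary part of [rho(z,u)] does not depend
    on [z - u] alone: as in the Heisenberg group, a change of base point adds a correction and a
    skew form that is quadratic in the distances. This is why boxes of width [sqrt l] go with an
    imaginary part of order [l], and why one box controls the kernel at any pair of its points. The
    harmonic weights fit both variables: their powers of exponent [p1 > 1] are summable, as the norm
    in the first variable requires, and they are bounded, which suffices for the supremum in the
    second. The equalities come first, because they turn the exponents of the tests at infinity into
    [- a1] and [- a2]. *)

Section ProductProjections.
Context d1 d2 d3 (A : measurableType d1) (B : measurableType d2) (C : measurableType d3).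

Lemma measurable_fst_fst : measurable_fun [set: (A * B * C)%type] (fun u => u.1.1).
Proof. apply: (measurableT_comp measurable_fst); exact: measurable_fst. Qed.

Lemma measurable_snd_fst : measurable_fun [set: (A * B * C)%type] (fun u => u.1.2).
Proof. apply: (measurableT_comp measurable_snd); exact: measurable_fst. Qed.

End ProductProjections.

Section RhoRecursion.
Variable R : realType.
Implicit Types k : nat.

(** The factor 4 clears the normalisation of [rho2], so that each further coordinate adds a
    polynomial with integer coefficients. *)
Definition re4 k (z u : CN R k.+1) : R := 4 * complex.Re (rho2 z u).
Definition im4 k (z u : CN R k.+1) : R := 4 * complex.Im (rho2 z u).

(** [Cspace] splits off the first coordinate while [rho] distinguishes the last one; the recursion
    therefore starts in dimension one and every later statement is about [k.+1]. *)
Lemma rho_base (u : CN R 1) : rho u = u.1.2.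
Proof. by rewrite /rho /= big_ord0 subr0. Qed.

Lemma rho_step k (u : CN R k.+2) : rho u = @rho R k.+1 u.2 - u.1.2 ^+ 2.
Proof. by rewrite /rho /= big_ord_recl /= opprD addrCA addrC. Qed.

Lemma rho2_step k (z u : CN R k.+2) :
  rho2 z u = ((4%:R)^-1%:C * (zc z 0 - (zc u 0)^*) ^+ 2 + @rho2 R k.+1 z.2 u.2)%C.
Proof. by rewrite /rho2 /= big_ord_recl /= -mulrDr addrA. Qed.

Lemma re4_base (z u : CN R 1) : re4 z u = 2 * (z.1.2 + u.1.2).
Proof. by rewrite /re4 /rho2 /= big_ord0 /zc /=; field. Qed.

Lemma im4_base (z u : CN R 1) : im4 z u = - 2 * (z.1.1 - u.1.1).
Proof. by rewrite /im4 /rho2 /= big_ord0 /zc /=; field. Qed.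

Lemma re4_step k (z u : CN R k.+2) : re4 z u =
  (z.1.1 - u.1.1) ^+ 2 - (z.1.2 + u.1.2) ^+ 2 + @re4 k z.2 u.2.
Proof.
rewrite /re4 rho2_step; case: (@rho2 R k.+1 z.2 u.2) => a b.
by rewrite /zc /=; field.
Qed.

Lemma im4_step k (z u : CN R k.+2) : im4 z u =
  2 * (z.1.1 - u.1.1) * (z.1.2 + u.1.2) + @im4 k z.2 u.2.
Proof.
rewrite /im4 rho2_step; case: (@rho2 R k.+1 z.2 u.2) => a b.
by rewrite /zc /=; field.
Qed.

(** The last coordinate is left free: in a box its real part is controlled through [im4] and its
    imaginary part through [rho]. *)
Fixpoint nearC k : CN R k.+1 -> CN R k.+1 -> R -> bool :=
  match k as k return CN R k.+1 -> CN R k.+1 -> R -> bool with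
  | 0 => fun _ _ _ => true
  | k.+1 => fun z u L =>
     (`|z.1.1 - u.1.1| <= L) && (`|z.1.2 - u.1.2| <= L) && @nearC k z.2 u.2 L
  end.

(* [v] and [s] collect the contributions of the coordinates already integrated
   out, so that the volume can be computed by induction on [k]. *)
Definition box k (z : CN R k.+1) (L M v s H0 H1 : R) : set (projT2 (Cspace R k.+1)) :=
  [set u | nearC z u L /\ `|v + im4 z u| <= M /\ H0 < rho u - s <= H1].

Lemma measurable_rho k : measurable_fun [set: projT2 (Cspace R k.+1)] (@rho R k.+1).
Proof.
elim: k => [|k IH].
  rewrite (_ : @rho R 1 = snd \o fst).
    apply: measurableT_comp; [exact: measurable_snd|exact: measurable_fst].
  by apply/funext => u; rewrite rho_base.
rewrite (_ : @rho R k.+2 = fun u => @rho R k.+1 u.2 - u.1.2 ^+ 2).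
  apply: measurable_funB.
    apply: (measurableT_comp IH); exact: measurable_snd.
  apply: measurable_funX.
  apply: (measurableT_comp measurable_snd); exact: measurable_fst.
by apply/funext => u; rewrite rho_step.
Qed.

Lemma measurable_re4 k (z : CN R k.+1) :
  measurable_fun [set: projT2 (Cspace R k.+1)] (@re4 k z).
Proof.
elim: k z => [|k IH] z.
  rewrite (_ : @re4 0 z = fun u => 2 * (z.1.2 + u.1.2)).
    by apply: measurable_funM => //; apply: measurable_funD => //; exact: measurable_snd_fst.
  by apply/funext => u; rewrite re4_base.
rewrite (_ : @re4 k.+1 z = fun u =>
  (z.1.1 - u.1.1) ^+ 2 - (z.1.2 + u.1.2) ^+ 2 + @re4 k z.2 u.2).
  apply: measurable_funD; last first.
    apply: (measurableT_comp (IH z.2)); exact: measurable_snd.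
  apply: measurable_funB; apply: measurable_funX.
    by apply: measurable_funB => //; exact: measurable_fst_fst.
  by apply: measurable_funD => //; exact: measurable_snd_fst.
by apply/funext => u; rewrite re4_step.
Qed.

Lemma measurable_im4 k (z : CN R k.+1) :
  measurable_fun [set: projT2 (Cspace R k.+1)] (@im4 k z).
Proof.
elim: k z => [|k IH] z.
  rewrite (_ : @im4 0 z = fun u => - 2 * (z.1.1 - u.1.1)).
    by apply: measurable_funM => //; apply: measurable_funB => //; exact: measurable_fst_fst.
  by apply/funext => u; rewrite im4_base.
rewrite (_ : @im4 k.+1 z = fun u =>
  2 * (z.1.1 - u.1.1) * (z.1.2 + u.1.2) + @im4 k z.2 u.2).
  apply: measurable_funD; last first.
    apply: (measurableT_comp (IH z.2)); exact: measurable_snd.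
  apply: measurable_funM; first apply: measurable_funM => //.
    by apply: measurable_funB => //; exact: measurable_fst_fst.
  by apply: measurable_funD => //; exact: measurable_snd_fst.
by apply/funext => u; rewrite im4_step.
Qed.

End RhoRecursion.

(** * Volume of boxes *)

Lemma measurable_bool_set d (T : measurableType d) (b : T -> bool) :
  measurable_fun setT b -> measurable [set x | b x].
Proof.
move=> mb; rewrite -[X in measurable X]setTI.
rewrite (_ : [set x | b x] = b @^-1` [set true]); first exact: mb.
by apply/seteqP; split => x /=.
Qed.

Section BoxMeasure.
Variable R : realType.
Implicit Types k : nat.

Lemma measurable_near k (z : CN R k.+1) L :
  measurable_fun [set: projT2 (Cspace R k.+1)] (fun u => nearC z u L).
Proof.
elim: k z => [|k IH] z; first exact: measurable_cst.
apply: measurable_and; last first.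
  apply: (measurableT_comp (IH z.2)); exact: measurable_snd.
apply: measurable_and; apply: measurable_fun_ler => //;
  apply: measurableT_comp => //; apply: measurable_funB => //.
  exact: measurable_fst_fst.
exact: measurable_snd_fst.
Qed.

Lemma measurable_box k (z : CN R k.+1) (L M v s H0 H1 : R) :
  measurable (box z L M v s H0 H1).
Proof.
rewrite (_ : box _ _ _ _ _ _ _ = [set u | nearC z u L &&
   ((`|v + im4 z u| <= M) && ((H0 < rho u - s) && (rho u - s <= H1)))]).
  apply: measurable_bool_set; apply: measurable_and; first exact: measurable_near.
  have mr : measurable_fun [set: projT2 (Cspace R k.+1)] (fun u => @rho R k.+1 u - s).
    by apply: measurable_funB => //; exact: measurable_rho.
  apply: measurable_and.
    apply: measurable_fun_ler => //; apply: measurableT_comp => //.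
    by apply: measurable_funD => //; exact: measurable_im4.
  by apply: measurable_and; [exact: measurable_fun_ltr|exact: measurable_fun_ler].
apply/seteqP; split => u /=; first by case=> -> [-> ->].
by case/andP => h1 /andP[h2 h3]; split.
Qed.

Lemma lebR_itvcc (a b : R) : a <= b -> lebR R `[a, b]%classic = (b - a)%:E.
Proof.
move=> ab; rewrite /lebR /= lebesgue_measure_itv /= lte_fin.
by case: ltgtP ab => // -> _; rewrite subrr.
Qed.

Lemma lebR_itvoc (a b : R) : a <= b -> lebR R `]a, b]%classic = (b - a)%:E.
Proof.
move=> ab; rewrite /lebR /= lebesgue_measure_itv /= lte_fin.
by case: ltgtP ab => // -> _; rewrite subrr.
Qed.

Lemma leb2X (A B : set R) : measurable A -> measurable B ->
  leb2 R (A `*` B) = (lebR R A * lebR R B)%E.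
Proof. by move=> mA mB; rewrite /leb2 /= /pmeasure product_measure1E. Qed.

Lemma lebCX k (A : set (R * R)) (B : set (projT2 (Cspace R k))) :
  measurable A -> measurable B ->
  lebC R k.+1 (A `*` B) = (leb2 R A * lebC R k B)%E.
Proof. by move=> mA mB; exact: product_measure1E. Qed.

Lemma lebC_xsection k (A : set (projT2 (Cspace R k.+1))) :
  lebC R k.+1 A = (\int[leb2 R]_p lebC R k (xsection A p))%E.
Proof. by []. Qed.

(** The volume does not depend on the shifts. Over each point of the square of side [2 * L] the
    section is a box of one dimension less, with [v] and [s] moved by the terms of [im4_step] and
    [rho_step], so all sections have the same volume. In the base case the factor 2 of [im4_base]
    turns the length [2 * M] into [M]. *)
Lemma box_measure k (z : CN R k.+1) (L M v s H0 H1 : R) :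
  0 <= L -> 0 <= M -> H0 <= H1 ->
  lebC R k.+1 (box z L M v s H0 H1) = ((2 * L) ^+ (2 * k) * M * (H1 - H0))%:E.
Proof.
move=> L0 M0 H01; elim: k z v s => [|k IH] z v s.
  rewrite (_ : box _ _ _ _ _ _ _ =
     (`[z.1.1 - (v + M) / 2, z.1.1 + (M - v) / 2]%classic `*`
      `]s + H0, s + H1]%classic) `*` setT).
    rewrite lebCX//; last exact: measurableX.
    rewrite leb2X// lebR_itvcc ?lebR_itvoc; [|lra|lra].
    rewrite [lebC R 0 _]diracT mule1 -EFinM; congr (_%:E); rewrite muln0 expr0 mul1r; by field.
  apply/seteqP; split => -[[x y] []] /=; rewrite /box /= im4_base rho_base /= !in_itv /=.
    by case=> _ [] /ler_normlP[h1 h2] /andP[h3 h4]; split => //; split; lra.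
  by case=> [[]] /andP[h1 h2] /andP[h3 h4] _; split => //; split; [apply/ler_normlP; split|]; lra.
pose I : set R := `[z.1.1 - L, z.1.1 + L]%classic.
pose J : set R := `[z.1.2 - L, z.1.2 + L]%classic.
have mI : measurable I by exact: measurable_itv.
have mJ : measurable J by exact: measurable_itv.
pose C := (2 * L) ^+ (2 * k) * M * (H1 - H0).
have C0 : 0 <= C by rewrite !mulr_ge0 ?exprn_ge0// ?mulr_ge0//; lra.
rewrite lebC_xsection.
under eq_integral => p _.
  rewrite (_ : lebC R k.+1 _ = (C%:E * (\1_(I `*` J) p)%:E)%E).
    over.
  rewrite indicE; have [pI|pI] := boolP (p \in I `*` J).
    rewrite mule1 -(IH z.2 (v + 2 * (z.1.1 - p.1) * (z.1.2 + p.2)) (s + p.2 ^+ 2)).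
    congr (lebC R k.+1 _); apply/seteqP; split => u /=; rewrite /xsection /= inE /box /= im4_step rho_step /=.
      by case=> /andP[_ ->]; rewrite !addrA opprD addrA (addrAC _ (- s)).
    move: pI; rewrite inE /I /J => -[] /=; rewrite !in_itv /= => /andP[h1 h2] /andP[h3 h4].
    case=> -> []; rewrite !addrA opprD addrA (addrAC _ (- s)) => -> ->; split => //.
    by rewrite andbT; apply/andP; split; apply/ler_normlP; split; lra.
  rewrite mule0 [X in lebC R k.+1 X](_ : _ = set0) ?measure0//.
  apply/seteqP; split => u //; rewrite /xsection /= inE /box /= => -[] /andP[/andP[h1 h2] _] _.
  move: pI; rewrite notin_setE /I /J /= !in_itv /=; apply.
  by move/ler_normlP : h1 => [? ?]; move/ler_normlP : h2 => [? ?]; split; lra.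
have mIJ : measurable (I `*` J) by exact: measurableX.
rewrite ge0_integralZl_EFin//; last first.
  by apply/measurable_EFinP; exact: measurable_indic.
have -> : (\int[leb2 R]_x (\1_(I `*` J) x)%:E = leb2 R (I `*` J))%E.
  by rewrite integral_indic// setIT.
rewrite leb2X// !lebR_itvcc; [|lra|lra].
by rewrite -!EFinM; congr (_%:E); rewrite /C mulnS exprD; ring.
Qed.

End BoxMeasure.

(** * Size of the kernel *)

Section RealAux.
Variable R : realType.
Implicit Types a b c q l m : R.

Lemma le_sum3 a b q l : 0 <= a -> 0 <= b -> 0 <= q -> a + b + q <= l ->
  [/\ a <= l, b <= l & q <= l].
Proof. by move=> *; split; lra. Qed.

Lemma dist_sqr_le a b c l :
  `|a - b| <= l -> `|a - c| <= l -> (b - c) ^+ 2 <= 4 * l ^+ 2.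
Proof.
move=> /ler_normlP[? ?] /ler_normlP[? ?].
have -> : 4 * l ^+ 2 = (2 * l) ^+ 2 by ring.
rewrite -real_normK ?num_real// ler_pXn2r ?nnegrE//; last by lra.
by apply/ler_normlP; split; lra.
Qed.

Lemma le_sum3_step a b q l m : a <= 4 * l -> b <= 4 * l -> q <= 8 * m * l ->
  a + b + q <= 8 * (m + 1) * l.
Proof. by move=> *; lra. Qed.

Lemma le_sum2_step a b l m : a <= l + l -> b <= 4 * m * l ->
  2 * a + b <= 4 * (m + 1) * l.
Proof. by move=> *; lra. Qed.

(** The terms that contain the possibly large [y0] as a factor cancel, and a skew form in the
    differences remains; hence the square of [l]. *)
Lemma skew_step l m (x0 y0 x y s t p q r : R) :
  `|x0 - x| <= l -> `|y0 - y| <= l -> `|x0 - s| <= l -> `|y0 - t| <= l ->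
  `|p - q + r| <= 4 * m * l ^+ 2 ->
  `|2 * (x - s) * (y + t) + p - (2 * (x0 - s) * (y0 + t) + q) +
    (2 * (x0 - x) * (y0 + y) + r)| <= 4 * (m + 1) * l ^+ 2.
Proof.
move=> h1 h2 h3 h4 h5.
rewrite (_ : _ + _ = 2 * ((x0 - x) * (y0 - t) - (x0 - s) * (y0 - y)) + (p - q + r)); last by ring.
apply: (le_trans (ler_normD _ _)); rewrite normrM [`|2|]ger0_norm//.
rewrite expr2; apply: le_sum2_step => //.
by apply: (le_trans (ler_normB _ _)); rewrite !normrM lerD// ler_pM.
Qed.

End RealAux.

Section RhoGeometry.
Variable R : realType.
Implicit Types k : nat.

(* Accessors at type [R]: the projections themselves are typed in the Borel
   space [measurableTypeR R], which hides the ordered field structure. *)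
Definition hdx k (z : CN R k.+1) : R := z.1.1.
Definition hdy k (z : CN R k.+1) : R := z.1.2.
Definition tlC k (z : CN R k.+1) : CN R k := z.2.

(** Taken as a difference, so that the decomposition of [re4] is immediate; [qdist_step] identifies
    it with the squared distance in the first [k] complex coordinates. *)
Definition qdist k (z u : CN R k.+1) : R := re4 z u - 2 * rho z - 2 * rho u.

Lemma qdist_base (z u : CN R 1) : qdist z u = 0.
Proof. by rewrite /qdist re4_base !rho_base; ring. Qed.

Lemma qdist_step k (z u : CN R k.+2) : qdist z u =
  (hdx z - hdx u) ^+ 2 + (hdy z - hdy u) ^+ 2 + qdist (tlC z) (tlC u).
Proof. by rewrite /qdist re4_step !rho_step /hdx /hdy /tlC; ring. Qed.

Lemma im4_step_hd k (z u : CN R k.+2) : im4 z u =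
  2 * (hdx z - hdx u) * (hdy z + hdy u) + im4 (tlC z) (tlC u).
Proof. exact: im4_step. Qed.

Lemma nearC_step k (z u : CN R k.+2) L : nearC z u L =
  [&& `|hdx z - hdx u| <= L, `|hdy z - hdy u| <= L & nearC (tlC z) (tlC u) L].
Proof. by rewrite andbA. Qed.

Lemma qdist_ge0 k (z u : CN R k.+1) : 0 <= qdist z u.
Proof.
elim: k z u => [|k IH] z u; first by rewrite qdist_base.
rewrite qdist_step; apply: addr_ge0; last exact: IH.
by apply: addr_ge0; exact: sqr_ge0.
Qed.

Lemma qdist_nearC k (z u : CN R k.+1) (L : R) :
  0 <= L -> qdist z u <= L ^+ 2 -> nearC z u L.
Proof.
move=> L0; elim: k z u => [//|k IH] z u; rewrite qdist_step nearC_step => h.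
have [h1 h2 h3] := le_sum3 (sqr_ge0 _) (sqr_ge0 _) (qdist_ge0 _ _) h.
apply/and3P; split; last exact: IH.
  by rewrite -(@ler_pXn2r _ 2)// ?nnegrE// real_normK ?num_real.
by rewrite -(@ler_pXn2r _ 2)// ?nnegrE// real_normK ?num_real.
Qed.

(** Each of the [2 * k] real differences is at most [2 * L], which gives the constant [8 * k]. *)
Lemma nearC_qdist k (z0 z u : CN R k.+1) (L : R) :
  nearC z0 z L -> nearC z0 u L -> qdist z u <= 8 * k%:R * L ^+ 2.
Proof.
elim: k z0 z u => [|k IH] z0 z u; first by rewrite qdist_base mulr0 mul0r.
rewrite !nearC_step qdist_step => /and3P[h1 h2 hz] /and3P[h3 h4 hu].
rewrite -(natr1 k); exact: (le_sum3_step (dist_sqr_le h1 h3) (dist_sqr_le h2 h4) (IH _ _ _ hz hu)).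
Qed.

(** Change of base point from [z0] to [z]. If [z] and [u] lie in boxes centred at [z0], the two
    terms with [z0] are bounded by membership, so this controls [im4 z u]. *)
Lemma nearC_im4 k (z0 z u : CN R k.+1) (L : R) :
  nearC z0 z L -> nearC z0 u L ->
  `|im4 z u - im4 z0 u + im4 z0 z| <= 4 * k%:R * L ^+ 2.
Proof.
elim: k z0 z u => [|k IH] z0 z u.
  rewrite !im4_base mulr0 mul0r => _ _.
  by rewrite (_ : _ + _ = 0) ?normr0//; ring.
rewrite !nearC_step !im4_step_hd => /and3P[h1 h2 hz] /and3P[h3 h4 hu].
rewrite -(natr1 k); exact: (skew_step h1 h2 h3 h4 (IH _ _ _ hz hu)).
Qed.

Lemma cabs_ge0 (w : R[i]) : 0 <= cabs w.
Proof. exact: sqrtr_ge0. Qed.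

Lemma Re_le_cabs (w : R[i]) : `|complex.Re w| <= cabs w.
Proof. by rewrite -sqrtr_sqr ler_wsqrtr// lerDl sqr_ge0. Qed.

Lemma Im_le_cabs (w : R[i]) : `|complex.Im w| <= cabs w.
Proof. by rewrite -sqrtr_sqr ler_wsqrtr// lerDr sqr_ge0. Qed.

Lemma cabs_le (w : R[i]) : cabs w <= `|complex.Re w| + `|complex.Im w|.
Proof.
rewrite -(@ler_pXn2r _ 2) ?nnegrE ?cabs_ge0 ?addr_ge0//.
rewrite sqr_sqrtr ?addr_ge0 ?sqr_ge0// sqrrD !real_normK ?num_real//.
by rewrite lerD2r lerDl mulrn_wge0// mulr_ge0.
Qed.

Lemma re4_cabs k (z u : CN R k.+1) : re4 z u <= 4 * cabs (rho2 z u).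
Proof. by rewrite /re4 ler_pM2l// (le_trans (ler_norm _))// Re_le_cabs. Qed.

Lemma im4_cabs k (z u : CN R k.+1) : `|im4 z u| <= 4 * cabs (rho2 z u).
Proof. by rewrite /im4 normrM [`|4|]ger0_norm// ler_pM2l// Im_le_cabs. Qed.

Lemma cabs_re4_im4 k (z u : CN R k.+1) :
  4 * cabs (rho2 z u) <= `|re4 z u| + `|im4 z u|.
Proof.
rewrite /re4 /im4 !normrM [`|4|]ger0_norm// -mulrDr ler_pM2l//.
exact: cabs_le.
Qed.

Lemma re4E k (z u : CN R k.+1) : re4 z u = 2 * rho z + 2 * rho u + qdist z u.
Proof. by rewrite /qdist; ring. Qed.

Lemma measurable_cabs_rho2 k (z : CN R k.+1) :
  measurable_fun [set: projT2 (Cspace R k.+1)] (fun u => cabs (rho2 z u)).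
Proof.
rewrite (_ : (fun u => _) = (fun u => Num.sqrt ((re4 z u / 4) ^+ 2 + (im4 z u / 4) ^+ 2))).
  apply: measurableT_comp.
    by apply: continuous_measurable_fun; exact: sqrt_continuous.
  apply: measurable_funD; apply: measurable_funX; apply: measurable_funM => //.
    exact: measurable_re4.
  exact: measurable_im4.
by apply/funext => u; rewrite /cabs /re4 /im4; congr (Num.sqrt _); field.
Qed.

End RhoGeometry.

Section DyadicAux.
Variable R : realType.

Lemma powR_expn (a b : R) j : 0 <= a -> (a ^+ j) `^ b = (a `^ b) ^+ j.
Proof.
by move=> a0; rewrite -powR_mulrn// powRAC powR_mulrn// powR_ge0.
Qed.

Lemma eseries_geometric (a q : R) : 0 <= a -> 0 <= q < 1 ->
  (\sum_(0 <= j <oo) (a * q ^+ j)%:E = (a / (1 - q))%:E)%E.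
Proof.
move=> a0 /andP[q0 q1]; apply/cvg_lim => //.
rewrite (_ : (fun n => _) = EFin \o (series (geometric a q))).
  by apply: cvg_EFin; [exact: nearW|apply: cvg_geometric_series; rewrite ger0_norm].
by apply/funext => n; rewrite /= /series /= sumEFin.
Qed.

Lemma dyadic_up (x y : R) : 0 < y -> y / 2 < x ->
  exists i : nat, 2 ^+ i * y / 2 < x <= 2 ^+ i * y.
Proof.
move=> y0 yx.
have ex : exists i : nat, x <= 2 ^+ i * y.
  exists (Num.Def.archi_bound (x / y)).
  by rewrite -ler_pdivrMr// ltW// upper_nthrootP.
case: (ex_minnP ex) => i hi imin; exists i; rewrite hi andbT.
case: i hi imin => [|i] _ imin; first by rewrite expr0 mul1r.
rewrite ltNge; apply/negP => h; have := imin i; rewrite ltnn => /(_ _)/negP; apply => //.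
by apply: (le_trans h); rewrite exprS; lra.
Qed.

Lemma dyadic_down (x y : R) : 0 < x -> x <= 2 * y ->
  exists j : nat, 2^-1 ^+ j * y < x <= 2 * (2^-1 ^+ j * y).
Proof.
move=> x0 xy; have y0 : 0 < y by lra.
have ex : exists j : nat, 2^-1 ^+ j * y < x.
  exists (Num.Def.archi_bound (y / x)).
  rewrite exprVn mulrC ltr_pdivrMr ?exprn_gt0// mulrC -ltr_pdivrMr//.
  exact: upper_nthrootP.
case: (ex_minnP ex) => j hj jmin; exists j; rewrite hj /=.
case: j hj jmin => [|j] _ jmin; first by rewrite expr0 mul1r.
rewrite leNgt; apply/negP => h; have := jmin j; rewrite ltnn => /(_ _)/negP; apply => //.
apply: (le_lt_trans _ h); rewrite exprS; lra.
Qed.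

(** The absolute value of the exponent lets one statement serve both signs of [c]. It is used to
    freeze each factor of the kernel on a box. *)
Lemma powR_comparable (K H t c : R) : 1 <= K -> 0 < H -> H / K <= t <= K * H ->
  K `^ (- `|c|) * H `^ c <= t `^ c <= K `^ `|c| * H `^ c.
Proof.
move=> K1 H0 /andP[h1 h2].
have K0 : 0 < K by lra.
have t0 : 0 < t by apply: lt_le_trans h1; rewrite divr_gt0.
have hK c' : (H / K) `^ c' = K `^ (- c') * H `^ c'.
  by rewrite powRM ?invr_ge0 ?ltW// -powR_inv1 ?ltW// -powRrM mulN1r mulrC.
have hK' c' : (K * H) `^ c' = K `^ c' * H `^ c' by rewrite powRM ?ltW.
have [c0|c0] := leP 0 c.
  rewrite (ger0_norm c0) -hK -hK'; apply/andP; split; apply: ge0_ler_powR => //;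
    rewrite ?nnegrE ?mulr_ge0 ?invr_ge0 ?ltW//.
rewrite (ltr0_norm c0) opprK -hK'.
have -> : t `^ c = (t `^ (- c))^-1 by rewrite powRN invrK.
have -> : (K * H) `^ c = ((K * H) `^ (- c))^-1 by rewrite powRN invrK.
have -> : K `^ (- c) * H `^ c = ((H / K) `^ (- c))^-1.
  by rewrite -powRN opprK hK.
have p (x y : R) : 0 < x -> x <= y -> (y `^ (- c))^-1 <= (x `^ (- c))^-1.
  move=> x0 xy; rewrite lef_pV2 ?posrE ?powR_gt0//; last by lra.
  by apply: ge0_ler_powR => //; rewrite ?nnegrE; lra.
by apply/andP; split; apply: p => //; rewrite divr_gt0.
Qed.

End DyadicAux.

(** * The Forelli-Rudin estimate *)

Section SeriesIntegral.
Local Open Scope ereal_scope.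
Context d (T : measurableType d) (R : realType).
Variable mu : {measure set T -> \bar R}.

Lemma eseries_term_le (E : nat -> \bar R) i : (forall j, 0 <= E j) ->
  E i <= \sum_(0 <= j <oo) E j.
Proof.
move=> E0; rewrite (nneseriesD1 (n := i))//.
by rewrite leeDl// nneseries_ge0.
Qed.

Lemma le_integral_eseries (D : set T) (F : T -> \bar R) (E : nat -> T -> \bar R) :
  measurable D -> measurable_fun D F -> (forall x, D x -> 0 <= F x) ->
  (forall i, measurable_fun D (E i)) -> (forall i x, 0 <= E i x) ->
  (forall x, D x -> F x <= \sum_(0 <= i <oo) E i x) ->
  \int[mu]_(x in D) F x <= \sum_(0 <= i <oo) \int[mu]_(x in D) E i x.
Proof.
move=> mD mF F0 mE E0 FE; rewrite -integral_nneseries//.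
by apply: ge0_le_integral => //; exact: ge0_emeasurable_sum.
Qed.

Lemma integral_scaled_indic (D G : set T) (c m : R) :
  measurable D -> measurable G -> (0 <= c)%R -> mu G <= m%:E ->
  \int[mu]_(x in D) (c * \1_G x)%:E <= (c * m)%:E.
Proof.
move=> mD mG c0 Gm; under eq_integral do rewrite EFinM.
rewrite ge0_integralZl_EFin//; last first.
  by apply/measurable_EFinP; apply: measurable_funTS; exact: measurable_indic.
rewrite integral_indic// EFinM lee_wpmul2l ?lee_fin//.
by apply: le_trans Gm; apply: le_measure; rewrite ?inE//; exact: measurableI.
Qed.

End SeriesIntegral.

Section ForelliRudin.
Variable R : realType.

Lemma powR_lt1 (a e : R) : 1 < a -> e < 0 -> a `^ e < 1.
Proof.
move=> a1 e0; rewrite /powR gt_eqF ?(lt_trans ltr01)// expR_lt1.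
by rewrite nmulr_rlt0// ln_gt0.
Qed.

Lemma measurable_TB k : measurable (@TB R k.+1 : set (projT2 (Cspace R k.+1))).
Proof.
apply: measurable_bool_set.
by apply: measurable_fun_ltr => //; exact: measurable_rho.
Qed.

Definition kern k (be ga : R) (z u : CN R k.+1) : R :=
  rho u `^ be / cabs (rho2 z u) `^ ga.

Lemma kern_ge0 k (be ga : R) (z u : CN R k.+1) : 0 <= kern be ga z u.
Proof. by rewrite divr_ge0 ?powR_ge0. Qed.

Lemma measurable_kern k (be ga : R) (z : CN R k.+1) :
  measurable_fun [set: projT2 (Cspace R k.+1)] (kern be ga z).
Proof.
rewrite (_ : kern be ga z = fun u => rho u `^ be * cabs (rho2 z u) `^ (- ga)).
  apply: measurable_funM.
    by apply: (measurableT_comp (measurable_powR _)); exact: measurable_rho.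
  by apply: (measurableT_comp (measurable_powR _)); exact: measurable_cabs_rho2.
by apply/funext => u; rewrite /kern -powRN.
Qed.

(** Both [qdist] and [im4] are at most [4 * l] in size; as [qdist] is a sum of squares, the width is
    [2 * Num.sqrt l]. *)
Lemma cabs_rho2_box k (z u : CN R k.+1) (l h : R) : 0 < rho z -> 0 <= l ->
  0 < rho u -> cabs (rho2 z u) <= l -> h < rho u <= 2 * h ->
  box z (2 * Num.sqrt l) (4 * l) 0 0 h (2 * h) u.
Proof.
move=> z0 l0 u0 cl hh; have := re4_cabs z u; rewrite re4E => hr.
have hi := im4_cabs z u.
split; last first.
  by rewrite add0r subr0; split => //; rewrite (le_trans hi)// ler_pM2l.
apply: qdist_nearC; first by rewrite mulr_ge0 ?sqrtr_ge0.
rewrite exprMn sqr_sqrtr//.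
have e : (2 ^+ 2 : R) = 4 by rewrite expr2; ring.
move: (qdist z u) (rho z) (rho u) (cabs _) z0 u0 hr cl {hi hh} => q a b c.
rewrite e; clear; lra.
Qed.

(** These bounds fix where the two dyadic sums begin: the modulus grows from [rho z / 2], and the
    height decreases from twice the modulus. *)
Lemma half_rho_lt_cabs k (z u : CN R k.+1) :
  0 < rho z -> 0 < rho u -> rho z / 2 < cabs (rho2 z u) /\ rho u <= 2 * cabs (rho2 z u).
Proof.
move=> z0 u0; have := re4_cabs z u; rewrite re4E; have := qdist_ge0 z u.
move: (qdist z u) (rho z) (rho u) (cabs _) z0 u0; clear => q a b c *; split; lra.
Qed.

(** Here [k.+2] stands for [n + 1]. The double series is geometric in both indices: the ratio [q1]
    is below 1 exactly by the condition on [ga] (decay at infinity), and [q2] exactly by [-1 < be]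
    (integrability at the boundary). *)
Lemma forelli_rudin k (be ga : R) : -1 < be -> k.+2%:R + be < ga ->
  exists C : R, 0 <= C /\ forall z : CN R k.+1, TB z ->
  (\int[lebC R k.+1]_(u in @TB R k.+1) (kern be ga z u)%:E <=
   (C * rho z `^ (k.+2%:R + be - ga))%:E)%E.
Proof.
move=> be1 ga1; pose e := k.+2%:R + be - ga.
(* The first two factors come from [powR_comparable] with [K = 2], the last two from the volume of
   the box. *)
pose A := 2 `^ `|be| * 2 `^ `|ga| * 16 ^+ k * 4 : R.
pose q1 := 2 `^ e : R; pose q2 := 2^-1 `^ (1 + be) : R.
have q11 : 0 <= q1 < 1.
  by rewrite powR_ge0 /= powR_lt1 ?ltr1n// subr_lt0.
have q21 : 0 <= q2 < 1.
  rewrite powR_ge0 /= /q2 -powR_inv1// -powRrM powR_lt1 ?ltr1n// mulN1r oppr_lt0.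
  by rewrite -ltrBlDl sub0r.
have A0 : 0 <= A by rewrite !mulr_ge0 ?powR_ge0 ?exprn_ge0.
exists (A / (1 - q1) / (1 - q2)); split.
  by case/andP: q11 => ? ?; case/andP: q21 => ? ?; do 2?[apply: divr_ge0 => //]; rewrite subr_ge0 ltW.
move=> z; rewrite /TB /= => z0; move: (erefl (rho z)) z0; move: {2 3}(rho z) => r rE r0.
(* [lam i] is the size of the modulus and [h i j] the height. Heights are measured relative to
   [lam i], which makes the general term a product of a power of [q1] and a power of [q2]. *)
pose lam i := 2 ^+ i * r : R.
have lam0 i : 0 < lam i by rewrite mulr_gt0 ?exprn_gt0.
pose h i j := 2^-1 ^+ j * lam i : R.
have h0 i j : 0 < h i j by rewrite mulr_gt0 ?exprn_gt0 ?invr_gt0.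
pose G i j := box z (2 * Num.sqrt (lam i)) (4 * lam i) 0 0 (h i j) (2 * h i j).
pose c i j := (2 `^ `|be| * h i j `^ be) * (2 `^ `|ga| * lam i `^ (- ga)).
have c0 i j : 0 <= c i j by rewrite !mulr_ge0 ?powR_ge0.
pose m i j := (16 * lam i) ^+ k * (4 * lam i) * h i j.
have Gm i j : (lebC R k.+1 (G i j) <= (m i j)%:E)%E.
  have hL : 0 <= 2 * Num.sqrt (lam i) by rewrite mulr_ge0 ?sqrtr_ge0.
  have hM : 0 <= 4 * lam i by rewrite mulr_ge0 ?ltW.
  have hH : h i j <= 2 * h i j by rewrite mulr_natl mulr2n lerDl ltW.
  rewrite (box_measure _ _ _ hL hM hH).
  rewrite lee_fin /m le_eqVlt; apply/orP; left; apply/eqP.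
  have sq : (2 * (2 * Num.sqrt (lam i))) ^+ 2 = 16 * lam i.
    by rewrite !exprMn sqr_sqrtr ?ltW//; ring.
  by rewrite exprM sq; congr (_ * _); ring.
have cm i j : c i j * m i j = A * r `^ e * q1 ^+ i * q2 ^+ j.
  have li0 : lam i != 0 by rewrite gt_eqF.
  have hE : h i j `^ be = (2^-1 `^ be) ^+ j * lam i `^ be.
    by rewrite powRM ?exprn_ge0 ?ltW// powR_expn.
  have qE : q2 ^+ j = 2^-1 ^+ j * (2^-1 `^ be) ^+ j.
    by rewrite /q2 powRD ?powRr1 ?exprMn// invr_eq0 pnatr_eq0 implybT.
  have lE : lam i `^ e = lam i ^+ k * lam i * lam i * (lam i `^ be * lam i `^ (- ga)).
    rewrite /e powRD ?li0 ?implybT// powRD ?li0 ?implybT// powR_mulrn ?ltW//.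
    by rewrite !exprSr !mulrA.
  have lE' : lam i `^ e = q1 ^+ i * r `^ e.
    by rewrite powRM ?exprn_ge0 ?ltW// powR_expn.
  rewrite -[RHS](_ : A * (q1 ^+ i * r `^ e) * q2 ^+ j = _); last by ring.
  rewrite -lE' lE qE /c /m /A hE (exprMn k 16) /h.
  move: (lam i) (lam i `^ be) (lam i `^ (- ga)) (2 `^ `|be|) (2 `^ `|ga|) (2^-1 ^+ j) (_ ^+ j) (16 ^+ k).
  by move=> a1 a2 a3 a4 a5 a6 a7 a8; move: (a1 ^+ k) => a9; ring.
have key (u : CN R k.+1) : TB u -> exists i j, G i j u /\ kern be ga z u <= c i j.
  rewrite /TB /= => u0.
  have [hz hu] := half_rho_lt_cabs (eq_ind_r (fun x => 0 < x) r0 rE) u0.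
  rewrite rE in hz.
  have [i /andP[i1 i2]] := dyadic_up r0 hz.
  have [j hj] : exists j, h i j < rho u <= 2 * h i j.
    by apply: dyadic_down => //; apply: (le_trans hu); rewrite ler_pM2l.
  exists i, j; split; first by apply: cabs_rho2_box => //; rewrite ?rE// ltW.
  rewrite /kern -powRN; apply: ler_pM; rewrite ?powR_ge0//.
    have /andP[h1 h2] := hj.
    have /(powR_comparable be (ler1n _ 2) (h0 i j))/andP[] :
       h i j / 2 <= rho u <= 2 * h i j; last by [].
    rewrite h2 andbT ltW// (lt_trans _ h1)// ltr_pdivrMr//.
    by rewrite mulr_natr mulr2n ltrDl.
  have /(powR_comparable (- ga) (ler1n _ 2) (lam0 i))/andP[] :
     lam i / 2 <= cabs (rho2 z u) <= 2 * lam i.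
    by rewrite (ltW i1) /= (le_trans i2)// mulr_natl mulr2n lerDl ltW.
  by rewrite normrN.
have mTB := @measurable_TB k.
have mind (i j : nat) : measurable_fun (@TB R k.+1 : set (projT2 (Cspace R k.+1)))
    (fun u => (c i j * \1_(G i j) u)%:E).
  apply/measurable_EFinP; apply: measurable_funM => //.
  by apply: measurable_funTS; apply: measurable_indic; exact: measurable_box.
have ind0 i j u : (0 <= (c i j * \1_(G i j) u)%:E)%E by rewrite lee_fin mulr_ge0.
have ineq := @le_integral_eseries _ _ R (lebC R k.+1) (@TB R k.+1)
  (fun u => (kern be ga z u)%:E)
  (fun i u => \sum_(0 <= j <oo) (c i j * \1_(G i j) u)%:E)%E.
apply: (le_trans (ineq _ _ _ _ _ _)) => {ineq} //.
- by apply/measurable_EFinP; apply: measurable_funTS; exact: measurable_kern.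
- by move=> u _; rewrite lee_fin kern_ge0.
- by move=> i; exact: ge0_emeasurable_sum.
- by move=> i u; apply: nneseries_ge0.
- move=> u /key[i [j [Gu ku]]].
  apply: (@le_trans _ _ (c i j * \1_(G i j) u)%:E).
    by rewrite lee_fin indicE mem_set// mulr1.
  apply: (le_trans (eseries_term_le (E := fun j => (c i j * \1_(G i j) u)%:E) j _)) => //.
  apply: (eseries_term_le (E := fun i => \sum_(0 <= j <oo) (c i j * \1_(G i j) u)%:E)%E) => i'.
  by apply: nneseries_ge0.
apply: (@le_trans _ _ (\sum_(0 <= i <oo) (\sum_(0 <= j <oo) (A * r `^ e * q1 ^+ i * q2 ^+ j)%:E))%E).
  apply: lee_nneseries => [i _ _|i _].
    by apply: integral_ge0 => u _; apply: nneseries_ge0.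
  rewrite integral_nneseries//; apply: lee_nneseries => [j _ _|j _].
    by apply: integral_ge0.
  rewrite -cm; apply: integral_scaled_indic => //; [exact: measurable_box|exact: Gm].
have Ar : 0 <= A * r `^ e by rewrite mulr_ge0 ?powR_ge0.
under eq_eseriesr => i _.
  rewrite eseries_geometric//; last by rewrite mulr_ge0// exprn_ge0//; case/andP: q11.
  rewrite mulrAC.
  over.
rewrite eseries_geometric//; last by rewrite mulr_ge0// invr_ge0; case/andP: q21 => ? ?; rewrite subr_ge0 ltW.
by rewrite lee_fin le_eqVlt; apply/orP; left; apply/eqP; rewrite rE -/e;
  move: (r `^ e) ((1 - q1)^-1) ((1 - q2)^-1) => a b d; ring.
Qed.

End ForelliRudin.

(** * Tonelli, Hoelder and complex integrals *)

Section Tonelli.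
Local Open Scope ereal_scope.
Context d1 d2 (T1 : measurableType d1) (T2 : measurableType d2) (R : realType).
Variable m1 : {sigma_finite_measure set T1 -> \bar R}.
Variable m2 : {sigma_finite_measure set T2 -> \bar R}.

Lemma tonelli_setX (A : set T1) (B : set T2) (g : T1 * T2 -> \bar R) :
  measurable A -> measurable B -> measurable_fun setT g -> (forall x, 0 <= g x) ->
  \int[pmeasure m1 m2]_(x in A `*` B) g x =
  \int[m2]_(y in B) \int[m1]_(x in A) g (x, y).
Proof.
move=> mA mB mg g0; rewrite integral_mkcond.
rewrite [LHS](fubini_tonelli2 (m1 := m1) (m2 := m2) (g \_ (A `*` B))); last 2 first.
  apply/(measurable_restrictT _ _).1; first exact: measurableX.
  exact: measurable_funTS.
  by move=> x; rewrite patchE; case: ifP.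
rewrite [RHS]integral_mkcond; apply: eq_integral => y _.
rewrite /fubini_G [RHS]patchE; case: ifPn => yB.
  rewrite [RHS]integral_mkcond; apply: eq_integral => x _.
  by rewrite !patchE in_setX yB andbT.
by rewrite integral0_eq// => x _; rewrite patchE in_setX (negbTE yB) andbF.
Qed.

Lemma measurable_inner_integral (A : set T1) (g : T1 * T2 -> \bar R) :
  measurable A -> measurable_fun setT g -> (forall x, 0 <= g x) ->
  measurable_fun setT (fun y => \int[m1]_(x in A) g (x, y)).
Proof.
move=> mA mg g0.
have := @measurable_fun_fubini_tonelli_G _ _ T1 T2 R m1 (g \_ (A `*` setT)).
rewrite (_ : fubini_G _ _ = (fun y => \int[m1]_(x in A) g (x, y))); last first.
  apply/funext => y; rewrite /fubini_G [RHS]integral_mkcond; apply: eq_integral => x _.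
  by rewrite !patchE in_setX in_setT andbT.
apply.
  apply/(measurable_restrictT _ _).1; first exact: measurableX.
  exact: measurable_funTS.
by move=> x; rewrite patchE; case: ifP.
Qed.

End Tonelli.

Section Hoelder.
Local Open Scope ereal_scope.
Context d (T : measurableType d) (R : realType).
Variable mu : {measure set T -> \bar R}.

Lemma hoelder_in (D : set T) (F G : T -> R) (p q : R) :
  measurable D -> measurable_fun setT F -> measurable_fun setT G ->
  (forall x, 0 <= F x)%R -> (forall x, 0 <= G x)%R ->
  (0 < p)%R -> (0 < q)%R -> (p^-1 + q^-1 = 1)%R ->
  \int[mu]_(x in D) (F x * G x)%:E <=
  (\int[mu]_(x in D) (F x `^ p)%:E) `^ p^-1 *
  (\int[mu]_(x in D) (G x `^ q)%:E) `^ q^-1.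
Proof.
move=> mD mF mG F0 G0 p0 q0 pq.
have mr (H : T -> R) : measurable_fun setT H -> measurable_fun setT (H \_ D : T -> R).
  move=> mH; apply/(measurable_restrictT _ _).1 => //; exact: measurable_funTS.
have E1 : \int[mu]_x `|(((F \_ D) \* (G \_ D)) x)%:E| = \int[mu]_(x in D) (F x * G x)%:E.
  rewrite [RHS]integral_mkcond; apply: eq_integral => x _.
  rewrite !patchE /= !patchE; case: ifP => _; last by rewrite mulr0 normr0.
  by rewrite ger0_norm// mulr_ge0.
have E2 (H : T -> R) (r : R) : (forall x, 0 <= H x)%R -> (0 < r)%R ->
   \int[mu]_x (`|((H \_ D) x)%:E| `^ r) = \int[mu]_(x in D) (H x `^ r)%:E.
  move=> H0 r0; rewrite [RHS]integral_mkcond; apply: eq_integral => x _.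
  rewrite !patchE; case: ifP => _ /=.
    by rewrite ger0_norm.
  by rewrite normr0 powR0// gt_eqF.
have N2 (H : T -> R) (r : R) : (forall x, 0 <= H x)%R -> (0 < r)%R ->
    Lnorm mu r%:E (EFin \o (H \_ D)) = (\int[mu]_(x in D) (H x `^ r)%:E) `^ r^-1.
  by move=> H0 r0; rewrite unlock; congr (_ `^ _); exact: E2.
rewrite -E1 -(N2 F)// -(N2 G)// -Lnorm1; exact: hoelder (mr _ mF) (mr _ mG) p0 q0 pq.
Qed.

End Hoelder.

Section ComplexIntegral.
Context d (T : measurableType d) (R : realType).
Variable mu : {measure set T -> \bar R}.

Lemma measurable_cabs (f : T -> R[i]) : cmeasurable f ->
  measurable_fun setT (fun x => cabs (f x)).
Proof.
case=> m1 m2; rewrite /cabs; apply: measurableT_comp.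
  by apply: continuous_measurable_fun; exact: sqrt_continuous.
by apply: measurable_funD; exact: measurable_funX.
Qed.

(** The factor 2 comes from bounding the real and the imaginary part separately by [M]. *)
Lemma dominated_cint (D : set T) (g : T -> R[i]) (h : T -> R) (M : R) :
  measurable D ->
  measurable_fun D (fun x => complex.Re (g x)) ->
  measurable_fun D (fun x => complex.Im (g x)) ->
  measurable_fun D h ->
  (forall x, D x -> cabs (g x) <= h x) ->
  (\int[mu]_(x in D) (h x)%:E <= M%:E)%E ->
  cintegrable mu D g /\ cabs (cint mu D g) <= 2 * M.
Proof.
move=> mD mRe mIm mh gh hM.
have h0 x : D x -> 0 <= h x by move=> /gh; apply: le_trans; exact: cabs_ge0.
have part (r : T -> R) : measurable_fun D r -> (forall x, D x -> `|r x| <= h x) ->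
    mu.-integrable D (EFin \o r) /\ `|Rintegral mu D r| <= M.
  move=> mr rh.
  have mr' : measurable_fun D (EFin \o r) by exact/measurable_EFinP.
  have le1 : (\int[mu]_(x in D) `|(EFin \o r) x| <= M%:E)%E.
    apply: le_trans hM; apply: ge0_le_integral => //.
    - exact: measurableT_comp.
    - exact/measurable_EFinP.
  have ir : mu.-integrable D (EFin \o r).
    by apply/integrableP; split => //; rewrite (le_lt_trans le1) ?ltry.
  split => //; rewrite -lee_fin EFin_normr_Rintegral//.
  exact: (le_trans (le_abse_integral _ _ _)).
have [iRe bRe] := part _ mRe (fun x Dx => le_trans (Re_le_cabs _) (gh x Dx)).
have [iIm bIm] := part _ mIm (fun x Dx => le_trans (Im_le_cabs _) (gh x Dx)).
split => //; apply: (le_trans (cabs_le _)); rewrite mulr_natl mulr2n.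
exact: lerD.
Qed.

End ComplexIntegral.

(** * Mixed norms *)

Section MixedNorm.
Variable R : realType.
Local Notation T k := (projT2 (Cspace R k.+1)).

Lemma box_sub_TB k (z : CN R k.+1) (L M v H0 H1 : R) : 0 <= H0 ->
  box z L M v 0 H0 H1 `<=` @TB R k.+1.
Proof.
move=> h u [_ [_]]; rewrite subr0 /TB /= => /andP[h1 _]; exact: le_lt_trans h1.
Qed.

(** On a null tube even a negative [M] would be admissible in the infimum that defines the mixed
    norm. *)
Lemma lebC_TB_neq0 k : lebC R k.+1 (@TB R k.+1) <> 0%E.
Proof.
move=> h; have : (lebC R k.+1 (box (point : T k) 1 1 0 0 1 2) <= 0)%E.
  rewrite -h; apply: le_measure; rewrite ?inE.
  - exact: measurable_box.
  - exact: measurable_TB.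
  - exact: box_sub_TB.
rewrite box_measure//; last by rewrite ler1n.
have -> : (2 - 1 : R) = 1 by ring.
rewrite lee_fin leNgt => /negP; apply.
by rewrite !mulr1 exprn_gt0.
Qed.

(** The weight is positive on the tube, so null sets for it are Lebesgue null there, whatever the
    exponent. *)
Lemma ae_TB_weighted_ae k (al : R) (P : CN R k.+1 -> Prop) :
  ae_TB_weighted al P -> {ae lebC R k.+1, forall w, TB w -> P w}.
Proof.
move=> [N [mN [N0 NP]]].
have mD : measurable (N `&` (@TB R k.+1 : set (T k))).
  by apply: measurableI => //; exact: measurable_TB.
have mf : measurable_fun [set: T k] (fun w => (rho w `^ al)%:E).
  apply/measurable_EFinP; apply: (measurableT_comp (measurable_powR _)).
  exact: measurable_rho.
have /(ae_eq_integral_abs _ mD (measurable_funTS mf)) :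
   (\int[lebC R k.+1]_(w in N `&` @TB R k.+1) `|(rho w `^ al)%:E| = 0)%E.
  by rewrite -N0; apply: eq_integral => w _; rewrite gee0_abs ?lee_fin ?powR_ge0.
apply: filterS => w h TBw; apply: contrapT => nP.
have [Nw|Nw] := pselect (N w); last by apply: nP; exact: NP.
have /(_ (conj Nw TBw)) := h; rewrite /= => -[] /eqP.
by rewrite powR_eq0 gt_eqF.
Qed.

Lemma mixed_norm_ge0 k (p1 al1 al2 : R) (f : CN R k.+1 * CN R k.+1 -> R[i]) :
  (0 <= mixed_norm_p_infty p1 al1 al2 f)%E.
Proof.
apply/ereal_infP => M /ae_TB_weighted_ae h; rewrite leNgt; apply/negP => M0.
apply: (@lebC_TB_neq0 k); apply: measure_negligible; first exact: measurable_TB.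
apply: negligibleS h => w /= TBw; apply/not_implyP; split => //.
by apply/negP; rewrite -ltNge (lt_le_trans M0)// poweR_ge0.
Qed.

Lemma mixed_norm_lt k (p1 al1 al2 N : R) (f : CN R k.+1 * CN R k.+1 -> R[i]) :
  (mixed_norm_p_infty p1 al1 al2 f < N%:E)%E ->
  {ae lebC R k.+1, forall w, TB w ->
   ((\int[lebC R k.+1]_(z in @TB R k.+1)
      ((cabs (f (z, w)) `^ p1) * rho z `^ al1)%:E) `^ p1^-1 <= N%:E)%E}.
Proof.
move=> /ereal_inf_lt[M /ae_TB_weighted_ae h /ltW MN].
by apply: filterS h => w h /h /le_trans; apply.
Qed.

(** Hoelder for the factors [g * rho ^ (al1 / p1)] and [kern * rho ^ (- al1 / p1)]. The conjugate
    power of the second is again a kernel, with exponents [be] and [ga]; for it [-1 < be] is the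
    condition on [b1], and the Forelli-Rudin exponent is [- a1 * q], negative because [0 < a1]. *)
Lemma inner_hoelder k (p1 al1 a1 b1 c1 : R) :
  1 < p1 -> 0 < a1 -> al1 + 1 < p1 * (b1 + 1) ->
  c1 = k.+2%:R + a1 + b1 - (k.+2%:R + al1) / p1 ->
  exists C : R, 0 <= C /\ forall (g : T k -> R) (z : CN R k.+1),
    measurable_fun setT g -> (forall u, 0 <= g u) -> TB z ->
  (\int[lebC R k.+1]_(u in @TB R k.+1) (kern b1 c1 z u * g u)%:E <=
   (\int[lebC R k.+1]_(u in @TB R k.+1) (g u `^ p1 * rho u `^ al1)%:E) `^ p1^-1 *
   (C * rho z `^ (- a1))%:E)%E.
Proof.
move=> p11 a10 b1c c1E; pose q := p1 / (p1 - 1).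
have p0 : 0 < p1 by lra.
have pN : p1 != 0 by rewrite gt_eqF.
have pm : 0 < p1 - 1 by lra.
have pmN : p1 - 1 != 0 by rewrite gt_eqF.
have q0 : 0 < q by rewrite divr_gt0.
have qN : q != 0 by rewrite gt_eqF.
have pq : p1^-1 + q^-1 = 1 by rewrite /q; field; rewrite pN pmN.
pose be := (b1 - al1 / p1) * q; pose ga := c1 * q.
have be1 : -1 < be.
  rewrite /be /q mulrA ltr_pdivlMr// mulrBl divfK//; lra.
have eE : k.+2%:R + be - ga = - a1 * q.
  by rewrite /be /ga c1E /q; field; rewrite pN pmN.
have ga1 : k.+2%:R + be < ga by rewrite -subr_lt0 eE mulNr oppr_lt0 mulr_gt0.
have [C [C0 HC]] := forelli_rudin be1 ga1.
exists (C `^ q^-1); split; first exact: powR_ge0.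
move=> g z mg g0 TBz.
pose s := al1 / p1.
pose F u := g u * rho u `^ s; pose G u := kern b1 c1 z u * rho u `^ (- s).
have mrho e : measurable_fun [set: T k] (fun u => rho u `^ e).
  by apply: (measurableT_comp (measurable_powR _)); exact: measurable_rho.
have mF : measurable_fun [set: T k] F by exact: measurable_funM.
have mG : measurable_fun [set: T k] G.
  by apply: measurable_funM => //; exact: measurable_kern.
have F0 u : 0 <= F u by rewrite mulr_ge0 ?powR_ge0.
have G0 u : 0 <= G u by rewrite mulr_ge0 ?powR_ge0 ?kern_ge0.
have := hoelder_in (lebC R k.+1) (@measurable_TB R k) mF mG F0 G0 p0 q0 pq.
rewrite (_ : (\int[lebC R k.+1]_(u in @TB R k.+1) (F u * G u)%:E)%E =
   (\int[lebC R k.+1]_(u in @TB R k.+1) (kern b1 c1 z u * g u)%:E)%E); last first.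
  apply: eq_integral => u; rewrite inE /TB /= => u0; congr (_%:E).
  have e : rho u `^ s * rho u `^ (- s) = 1.
    by rewrite -powRD ?subrr ?powRr0// (gt_eqF u0) implybT.
  rewrite /F /G; move: e; move: (rho u `^ s) (rho u `^ (- s)) (kern _ _ _ _) (g u).
  by move=> x y K v e; rewrite mulrACA e mulr1 mulrC.
rewrite (_ : (\int[lebC R k.+1]_(u in @TB R k.+1) (F u `^ p1)%:E)%E =
   (\int[lebC R k.+1]_(u in @TB R k.+1) (g u `^ p1 * rho u `^ al1)%:E)%E); last first.
  apply: eq_integral => u _; congr (_%:E).
  by rewrite /F powRM ?powR_ge0// -powRrM /s divfK.
rewrite (_ : (\int[lebC R k.+1]_(u in @TB R k.+1) (G u `^ q)%:E)%E =
   (\int[lebC R k.+1]_(u in @TB R k.+1) (kern be ga z u)%:E)%E); last first.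
  apply: eq_integral => u; rewrite inE /TB /= => u0; congr (_%:E).
  rewrite /G /kern powRM ?powR_ge0 ?divr_ge0 ?powR_ge0// powRM ?powR_ge0 ?invr_ge0 ?powR_ge0//.
  rewrite -!powRN -!powRrM mulrAC -powRD; last by rewrite (gt_eqF u0) implybT.
  by rewrite -mulrDl /be /ga mulNr.
move=> h; apply: (le_trans h); apply: lee_wpmul2l; first exact: poweR_ge0.
have -> : (C `^ q^-1 * rho z `^ (- a1))%:E = ((C * rho z `^ (k.+2%:R + be - ga))%:E `^ q^-1)%E.
  by rewrite poweR_EFin powRM ?powR_ge0// eE -powRrM mulrK// unitfE.
apply: gt0_ler_poweR; first by rewrite invr_ge0 ltW.
- by rewrite in_itv /= leey andbT; apply: integral_ge0 => u _; rewrite lee_fin kern_ge0.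
- by rewrite in_itv /= leey andbT lee_fin mulr_ge0 ?powR_ge0.
exact: HC.
Qed.

End MixedNorm.

(** * Double integral of the modulus *)

Section Sufficiency.
Variable R : realType.
Local Notation T k := (projT2 (Cspace R k.+1)).

Definition dkern k (b1 b2 c1 c2 : R) (z w : CN R k.+1) (ue : CN R k.+1 * CN R k.+1) : R :=
  kern b1 c1 z ue.1 * kern b2 c2 w ue.2.

Lemma dkern_ge0 k (b1 b2 c1 c2 : R) (z w : CN R k.+1) ue :
  0 <= dkern b1 b2 c1 c2 z w ue.
Proof. by rewrite mulr_ge0 ?kern_ge0. Qed.

Lemma measurable_dkern k (b1 b2 c1 c2 : R) (z w : CN R k.+1) :
  measurable_fun [set: (T k * T k)%type] (dkern b1 b2 c1 c2 z w).
Proof.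
apply: measurable_funM.
  apply: (measurableT_comp (measurable_kern _ _ _)); exact: measurable_fst.
apply: (measurableT_comp (measurable_kern _ _ _)); exact: measurable_snd.
Qed.

(** The first variable is integrated first, by Hoelder on almost every slice. The essential supremum
    in the second variable then comes out as a constant, and what is left is the Forelli-Rudin
    integral with exponent [- a2]. *)
Lemma S_integral_bound k (p1 al1 al2 a1 a2 b1 b2 c1 c2 : R) :
  1 < p1 -> 0 < a1 -> 0 < a2 -> al1 + 1 < p1 * (b1 + 1) -> -1 < b2 ->
  c1 = k.+2%:R + a1 + b1 - (k.+2%:R + al1) / p1 ->
  c2 = k.+2%:R + a2 + b2 ->
  exists C : R, 0 <= C /\ forall (f : T k * T k -> R[i]) (N : R) (z w : CN R k.+1),
    cmeasurable f -> (mixed_norm_p_infty p1 al1 al2 f <= N%:E)%E -> TB z -> TB w ->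
  (\int[@dV2 R k.+1]_(ue in @TB R k.+1 `*` @TB R k.+1)
     (dkern b1 b2 c1 c2 z w ue * cabs (f ue))%:E <=
   (C * N * (rho z `^ (- a1) * rho w `^ (- a2)))%:E)%E.
Proof.
move=> p11 a10 a20 b1c b2c c1E c2E.
have [C1 [C10 H1]] := inner_hoelder p11 a10 b1c c1E.
have c2g : k.+2%:R + b2 < c2 by rewrite c2E; lra.
have [C2 [C20 H2]] := forelli_rudin b2c c2g.
have e2 : k.+2%:R + b2 - c2 = - a2 by rewrite c2E; ring.
exists (C1 * C2); split; first by rewrite mulr_ge0.
move=> f N z w mf fN TBz TBw.
have mTB := @measurable_TB R k.
have macf := measurable_cabs mf.
have mg : measurable_fun setT (fun ue => (dkern b1 b2 c1 c2 z w ue * cabs (f ue))%:E).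
  by apply/measurable_EFinP; apply: measurable_funM => //; exact: measurable_dkern.
have g0 ue : (0 <= (dkern b1 b2 c1 c2 z w ue * cabs (f ue))%:E)%E.
  by rewrite lee_fin mulr_ge0 ?dkern_ge0 ?cabs_ge0.
pose P := rho z `^ (- a1) * rho w `^ (- a2).
have P0 : 0 <= P by rewrite mulr_ge0 ?powR_ge0.
(* The infimum in the norm need not be attained, so the slices are first bounded by some [N']
   strictly above the norm, and [N'] then decreases to [N]. *)
suff main (N' : R) : 0 <= N' -> (mixed_norm_p_infty p1 al1 al2 f < N'%:E)%E ->
    (\int[@dV2 R k.+1]_(ue in @TB R k.+1 `*` @TB R k.+1)
     (dkern b1 b2 c1 c2 z w ue * cabs (f ue))%:E <= (C1 * C2 * N' * P)%:E)%E.
  have N0 : 0 <= N by rewrite -lee_fin (le_trans _ fN)// mixed_norm_ge0.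
  (* The summand 1 keeps [K] positive when the constants vanish; the excess [e / K] costs at most
     [e]. *)
  apply/lee_addgt0Pr => e e0; pose K := C1 * C2 * P + 1.
  have K0 : 0 < K by apply: ltr_wpDl => //; exact: mulr_ge0 (mulr_ge0 C10 C20) P0.
  have eK : 0 < e / K by rewrite divr_gt0.
  apply: (le_trans (main (N + e / K) _ _)).
  - by rewrite addr_ge0// ltW.
  - by apply: (le_lt_trans fN); rewrite lte_fin ltrDl.
  rewrite -EFinD lee_fin -/P mulrDr mulrDl lerD2l.
  rewrite (_ : _ * P = (C1 * C2 * P) / K * e); last by move: K^-1 (P) => x y; ring.
  rewrite ler_piMl ?(ltW e0)// ler_pdivrMr// mul1r /K lerDl//.
move=> N0 /mixed_norm_lt fN'.
rewrite /dV2 tonelli_setX//.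
pose K := C1 * rho z `^ (- a1).
have K0 : 0 <= K by rewrite mulr_ge0 ?powR_ge0.
have inner y : (\int[lebC R k.+1]_(x in @TB R k.+1) (dkern b1 b2 c1 c2 z w (x, y) * cabs (f (x, y)))%:E <=
  (kern b2 c2 w y)%:E * ((\int[lebC R k.+1]_(x in @TB R k.+1)
      ((cabs (f (x, y)) `^ p1) * rho x `^ al1)%:E) `^ p1^-1 * K%:E))%E.
  have mfy : measurable_fun setT (fun x => cabs (f (x, y))).
    by have := measurable_fun_pair1 y macf.
  under eq_integral do rewrite /dkern /= mulrAC mulrC EFinM.
  rewrite ge0_integralZl_EFin ?kern_ge0//; last 2 first.
  - by move=> x _; rewrite lee_fin mulr_ge0 ?kern_ge0 ?cabs_ge0.
  - apply/measurable_EFinP; apply: measurable_funTS; apply: measurable_funM => //.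
    exact: measurable_kern.
  apply: lee_wpmul2l; first by rewrite lee_fin kern_ge0.
  by apply: H1 => // x; exact: cabs_ge0.
apply: (@le_trans _ _ (\int[lebC R k.+1]_(y in @TB R k.+1) (N' * K * kern b2 c2 w y)%:E)%E).
  apply: ae_ge0_le_integral => //.
  - by move=> y _; apply: integral_ge0.
  - apply: measurable_funTS; exact: (measurable_inner_integral (lebC R k.+1) mTB mg g0).
  - by move=> y _; rewrite lee_fin; apply: mulr_ge0; [exact: mulr_ge0|exact: kern_ge0].
  - apply/measurable_EFinP; apply: measurable_funTS; apply: measurable_funM => //.
    exact: measurable_kern.
  apply: filterS fN' => y h /h{}h; apply: (le_trans (inner y)).
  rewrite [leRHS](_ : _ = (kern b2 c2 w y)%:E * (N'%:E * K%:E))%E; last first.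
    by rewrite -!EFinM; congr (_%:E); rewrite mulrC.
  apply: lee_wpmul2l; first by rewrite lee_fin kern_ge0.
  by apply: lee_wpmul2r => //; rewrite lee_fin.
under eq_integral do rewrite EFinM.
have mk : measurable_fun (@TB R k.+1 : set (T k)) (fun y => (kern b2 c2 w y)%:E).
  apply/measurable_EFinP; apply: measurable_funTS; exact: measurable_kern.
rewrite (@ge0_integralZl_EFin _ _ _ _ _ mTB _ _ mk _ (mulr_ge0 N0 K0)); last first.
  by move=> x _; rewrite lee_fin kern_ge0.
apply: (@le_trans _ _ ((N' * K)%:E * (C2 * rho w `^ (- a2))%:E)%E).
  by rewrite -e2; apply: lee_wpmul2l; [rewrite lee_fin mulr_ge0|exact: H2].
rewrite -EFinM lee_fin le_eqVlt; apply/orP; left; apply/eqP; rewrite /K /P.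
by move: (rho z `^ _) (rho w `^ _) => x y; ring.
Qed.

End Sufficiency.

(** * The kernels of S and T *)

Section Kernels.
Variable R : realType.
Local Notation T k := (projT2 (Cspace R k.+1)).
Local Open Scope complex_scope.

Lemma Re_realM (r : R) (w : R[i]) : complex.Re (r%:C * w) = r * complex.Re w.
Proof. by case: w => a b /=; rewrite mul0r subr0. Qed.

Lemma Im_realM (r : R) (w : R[i]) : complex.Im (r%:C * w) = r * complex.Im w.
Proof. by case: w => a b /=; rewrite mul0r addr0. Qed.

Lemma cabs_realM (r : R) (w : R[i]) : 0 <= r -> cabs (r%:C * w) = r * cabs w.
Proof.
move=> r0; rewrite /cabs Re_realM Im_realM !exprMn -mulrDr sqrtrM ?sqr_ge0//.
by rewrite sqrtr_sqr ger0_norm.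
Qed.

Lemma cabs_real (r : R) : 0 <= r -> cabs r%:C = r.
Proof. by move=> r0; rewrite /cabs /= expr0n addr0 sqrtr_sqr ger0_norm. Qed.

Lemma SkernelE k (b1 b2 c1 c2 : R) (f : CN R k.+1 * CN R k.+1 -> R[i]) z w ue :
  Skernel b1 b2 c1 c2 f z w ue = (dkern b1 b2 c1 c2 z w ue)%:C * f ue.
Proof. by rewrite /Skernel /dkern /kern mulf_div. Qed.

Definition phase k (c1 c2 : R) (z w : CN R k.+1) (ue : CN R k.+1 * CN R k.+1) : R :=
  c1 * carg (rho2 z ue.1) + c2 * carg (rho2 w ue.2).

Lemma TkernelE k (b1 b2 c1 c2 : R) (f : CN R k.+1 * CN R k.+1 -> R[i]) z w ue :
  Tkernel b1 b2 c1 c2 f z w ue = (dkern b1 b2 c1 c2 z w ue)%:C *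
    ((cos (phase c1 c2 z w ue) -i* sin (phase c1 c2 z w ue)) * f ue).
Proof.
rewrite /Tkernel /dkern /kern /cpow /phase.
set x := c1 * _; set y := c2 * _; set r1 := _ `^ c1; set r2 := _ `^ c2.
have -> : r1%:C * (cos x +i* sin x) * (r2%:C * (cos y +i* sin y)) =
   (r1 * r2)%:C * (cos (x + y) +i* sin (x + y)).
  rewrite cosD sinD; apply/eqP; rewrite eq_complex /=; apply/andP; split; apply/eqP; ring.
have E : (cos (x + y) +i* sin (x + y))^-1 = cos (x + y) -i* sin (x + y) :> R[i].
  have h : (cos (x + y) -i* sin (x + y)) * (cos (x + y) +i* sin (x + y)) = 1 :> R[i].
    apply/eqP; rewrite eq_complex /=; apply/andP; split; apply/eqP; last by ring.
    by rewrite mulNr opprK -!expr2 cos2Dsin2.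
  have n0 : cos (x + y) +i* sin (x + y) != 0 :> R[i].
    apply/eqP => h0; move: h; rewrite h0 mulr0 => /eqP.
    by rewrite eq_sym oner_eq0.
  by apply: (mulIf n0); rewrite mulVf// h.
by rewrite invfM E mulf_div [in RHS]rmorphM /= fmorphV -!mulrA.
Qed.

Lemma cabs_Tkernel k (b1 b2 c1 c2 : R) (f : CN R k.+1 * CN R k.+1 -> R[i]) z w ue :
  cabs (Tkernel b1 b2 c1 c2 f z w ue) = dkern b1 b2 c1 c2 z w ue * cabs (f ue).
Proof.
rewrite TkernelE cabs_realM ?dkern_ge0//; congr (_ * _).
case: (f ue) => a b; rewrite /cabs /=; congr (Num.sqrt _).
move: (cos2Dsin2 (phase c1 c2 z w ue)).
move: (cos _) (sin _) => c s h.
by rewrite -[RHS]mul1r -h; ring.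
Qed.

(** The real part of [rho2] is positive on the tube, so only the first branch of [carg] occurs. The
    power [-1] in place of a division makes measurability an instance of [measurable_powR]. *)
Lemma carg_TB k (z u : CN R k.+1) : TB z -> TB u ->
  carg (rho2 z u) = atan (im4 z u * re4 z u `^ (-1)).
Proof.
rewrite /TB /= => z0 u0; have := re4E z u; have := qdist_ge0 z u => q0 reE.
have re0 : 0 < re4 z u.
  rewrite reE; move: z0 u0 q0; move: (rho z) (rho u) (qdist z u); clear => *; lra.
rewrite powR_inv1 ?ltW//.
have Re0 : 0 < complex.Re (rho2 z u) by move: re0; rewrite /re4 pmulr_rgt0.
rewrite /carg Re0 /im4 /re4; congr atan; move: Re0.
by move: (complex.Re _) (complex.Im _) => a b a0; rewrite -mulf_div divff ?mul1r.
Qed.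

Lemma measurable_phase k (c1 c2 : R) (z w : CN R k.+1) : TB z -> TB w ->
  measurable_fun ((@TB R k.+1 `*` @TB R k.+1) : set (T k * T k)) (phase c1 c2 z w).
Proof.
move=> TBz TBw.
pose h (c : R) (z u : T k) := c * atan (im4 z u * re4 z u `^ (-1)).
apply: (@eq_measurable_fun _ _ _ _ _ (fun ue => h c1 z ue.1 + h c2 w ue.2)).
  by move=> ue; rewrite inE => -[u1 u2]; rewrite /phase /h !carg_TB.
have mh c v : measurable_fun setT (h c v).
  apply: measurable_funM => //; apply: measurableT_comp.
    apply: continuous_measurable_fun => x; exact: continuous_atan.
  apply: measurable_funM; first exact: measurable_im4.
  by apply: (measurableT_comp (measurable_powR _)); exact: measurable_re4.
apply: measurable_funTS; apply: measurable_funD.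
  by apply: (measurableT_comp (mh _ _)); exact: measurable_fst.
by apply: (measurableT_comp (mh _ _)); exact: measurable_snd.
Qed.

Lemma measurable_Tkernel k (b1 b2 c1 c2 : R) (f : T k * T k -> R[i]) z w :
  TB z -> TB w -> cmeasurable f ->
  let D : set (T k * T k) := (@TB R k.+1 `*` @TB R k.+1) in
  measurable_fun D (fun ue => complex.Re (Tkernel b1 b2 c1 c2 f z w ue)) /\
  measurable_fun D (fun ue => complex.Im (Tkernel b1 b2 c1 c2 f z w ue)).
Proof.
move=> TBz TBw [mRe mIm] D.
have mcos : measurable_fun D (fun ue => cos (phase c1 c2 z w ue)).
  apply: measurableT_comp; last exact: measurable_phase.
  by apply: continuous_measurable_fun; exact: continuous_cos.
have msin : measurable_fun D (fun ue => sin (phase c1 c2 z w ue)).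
  apply: measurableT_comp; last exact: measurable_phase.
  by apply: continuous_measurable_fun; exact: continuous_sin.
have mk : measurable_fun D (dkern b1 b2 c1 c2 z w).
  apply: measurable_funTS; exact: measurable_dkern.
have mR : measurable_fun D (fun x => complex.Re (f x)) by exact: measurable_funTS.
have mI : measurable_fun D (fun x => complex.Im (f x)) by exact: measurable_funTS.
split.
  rewrite (_ : (fun ue => _) = fun ue => dkern b1 b2 c1 c2 z w ue *
     (cos (phase c1 c2 z w ue) * complex.Re (f ue) +
      sin (phase c1 c2 z w ue) * complex.Im (f ue))).
    by apply: measurable_funM => //; apply: measurable_funD; exact: measurable_funM.
  apply/funext => ue; rewrite TkernelE Re_realM; congr (_ * _).
  by case: (f ue) => a b /=; rewrite mulNr opprK.
rewrite (_ : (fun ue => _) = fun ue => dkern b1 b2 c1 c2 z w ue *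
     (cos (phase c1 c2 z w ue) * complex.Im (f ue) -
      sin (phase c1 c2 z w ue) * complex.Re (f ue))).
  by apply: measurable_funM => //; apply: measurable_funB; exact: measurable_funM.
apply/funext => ue; rewrite TkernelE Im_realM; congr (_ * _).
by case: (f ue) => a b /=; rewrite mulNr.
Qed.

End Kernels.

(** * From the conditions to [S], and from [S] to [T] *)

Section Implications.
Variable R : realType.
Local Notation T k := (projT2 (Cspace R k.+1)).
Local Open Scope complex_scope.

Lemma measurable_TBX k : measurable ((@TB R k.+1 `*` @TB R k.+1) : set (T k * T k)).
Proof. by apply: measurableX; exact: measurable_TB. Qed.

Lemma mixed_norm_fineE k (p1 al1 al2 : R) (f : CN R k.+1 * CN R k.+1 -> R[i]) :
  (mixed_norm_p_infty p1 al1 al2 f < +oo)%E ->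
  mixed_norm_p_infty p1 al1 al2 f = (fine (mixed_norm_p_infty p1 al1 al2 f))%:E.
Proof. by move=> foo; rewrite fineK// ge0_fin_numE// mixed_norm_ge0. Qed.

Lemma S_bounded_sufficient k (p1 al1 al2 a1 a2 b1 b2 c1 c2 : R) :
  1 < p1 -> 0 < a1 -> 0 < a2 -> al1 + 1 < p1 * (b1 + 1) -> -1 < b2 ->
  c1 = k.+2%:R + a1 + b1 - (k.+2%:R + al1) / p1 ->
  c2 = k.+2%:R + a2 + b2 ->
  @S_bounded R k.+1 p1 al1 al2 a1 a2 b1 b2 c1 c2.
Proof.
move=> p11 a10 a20 b1c b2c c1E c2E.
have [C [C0 H]] := S_integral_bound al2 p11 a10 a20 b1c b2c c1E c2E.
exists (2 * C) => f mf foo.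
have fE := mixed_norm_fineE foo.
set N := fine _ in fE.
have [mRe mIm] := mf.
have mdk z w : measurable_fun [set: (T k * T k)%type] (dkern b1 b2 c1 c2 z w).
  exact: measurable_dkern.
have key z w : TB z -> TB w ->
    cintegrable (@dV2 R k.+1) (@TB R k.+1 `*` @TB R k.+1) (Skernel b1 b2 c1 c2 f z w) /\
    cabs (cint (@dV2 R k.+1) (@TB R k.+1 `*` @TB R k.+1) (Skernel b1 b2 c1 c2 f z w)) <=
    2 * (C * N * (rho z `^ (- a1) * rho w `^ (- a2))).
  move=> TBz TBw.
  apply: (@dominated_cint _ _ _ _ _ _ (fun ue => dkern b1 b2 c1 c2 z w ue * cabs (f ue))).
  - exact: measurable_TBX.
  - apply: measurable_funTS.
    rewrite (_ : (fun x => _) = fun ue => dkern b1 b2 c1 c2 z w ue * complex.Re (f ue)).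
      exact: measurable_funM.
    by apply/funext => ue; rewrite SkernelE Re_realM.
  - apply: measurable_funTS.
    rewrite (_ : (fun x => _) = fun ue => dkern b1 b2 c1 c2 z w ue * complex.Im (f ue)).
      exact: measurable_funM.
    by apply/funext => ue; rewrite SkernelE Im_realM.
  - apply: measurable_funTS; apply: measurable_funM => //; exact: measurable_cabs.
  - by move=> ue _; rewrite SkernelE cabs_realM// dkern_ge0.
  - by apply: H => //; rewrite fE.
split; apply: aeW => -[z w] [/= TBz TBw]; first by have [] := key z w TBz TBw.
rewrite fE -EFinM lee_fin /Sop cabs_realM ?mulr_ge0 ?powR_ge0//=.
have [_ h] := key z w TBz TBw.
apply: (le_trans (ler_wpM2l _ h)); first by rewrite mulr_ge0 ?powR_ge0.
have cancel (a : R) (v : CN R k.+1) : TB v -> rho v `^ a * rho v `^ (- a) = 1.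
  by rewrite /TB /= => v0; rewrite -powRD ?subrr ?powRr0// (gt_eqF v0) implybT.
move: (cancel a1 z TBz) (cancel a2 w TBw).
move: (rho z `^ a1) (rho z `^ (- a1)) (rho w `^ a2) (rho w `^ (- a2)) => x x' y y' hx hy.
rewrite le_eqVlt; apply/orP; left; apply/eqP.
rewrite [LHS](_ : _ = (x * x') * (y * y') * (2 * C * N)); last by ring.
by rewrite hx hy !mul1r.
Qed.

Lemma eq_mixed_norm k (p1 al1 al2 : R) (f g : CN R k.+1 * CN R k.+1 -> R[i]) :
  (fun ue => cabs (g ue)) = (fun ue => cabs (f ue)) ->
  mixed_norm_p_infty p1 al1 al2 g = mixed_norm_p_infty p1 al1 al2 f.
Proof.
pose N (h : CN R k.+1 * CN R k.+1 -> R) : \bar R :=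
  ereal_inf [set M : \bar R | ae_TB_weighted al2 (fun w =>
     ((\int[lebC R k.+1]_(z in @TB R k.+1) (h (z, w) `^ p1 * rho z `^ al1)%:E) `^ p1^-1
       <= M)%E)].
have NE h : mixed_norm_p_infty p1 al1 al2 h = N (fun ue => cabs (h ue)) by [].
by move=> gf; rewrite !NE gf.
Qed.

(** The kernel of [S] at [g] is the modulus of the kernel of [T] at [f], so it serves as dominating
    function; the 2 is that of [dominated_cint]. *)
Lemma Tkernel_dominated k (b1 b2 c1 c2 : R) (f : T k * T k -> R[i]) :
  cmeasurable f -> forall z w : CN R k.+1, TB z -> TB w ->
  let g : T k * T k -> R[i] := fun ue => (cabs (f ue))%:C in
  let D : set (T k * T k) := @TB R k.+1 `*` @TB R k.+1 in
  cintegrable (@dV2 R k.+1) D (Skernel b1 b2 c1 c2 g z w) ->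
  cintegrable (@dV2 R k.+1) D (Tkernel b1 b2 c1 c2 f z w) /\
  cabs (cint (@dV2 R k.+1) D (Tkernel b1 b2 c1 c2 f z w)) <=
  2 * complex.Re (cint (@dV2 R k.+1) D (Skernel b1 b2 c1 c2 g z w)).
Proof.
move=> mf z w TBz TBw g D [iRe _].
have [mRe mIm] := @measurable_Tkernel R k b1 b2 c1 c2 f z w TBz TBw mf.
have SE : (fun ue => dkern b1 b2 c1 c2 z w ue * cabs (f ue)) =
          (fun ue => complex.Re (Skernel b1 b2 c1 c2 g z w ue)).
  by apply/funext => ue; rewrite SkernelE Re_realM.
apply: (@dominated_cint _ _ _ _ _ _ (fun ue => dkern b1 b2 c1 c2 z w ue * cabs (f ue))).
- exact: measurable_TBX.
- exact: mRe.
- exact: mIm.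
- rewrite SE; apply/measurable_EFinP; exact: measurable_int iRe.
- by move=> ue _; rewrite cabs_Tkernel lexx.
- rewrite [X in (\int[_]_(x in _) (X x)%:E <= _)%E]SE /= /Rintegral fineK.
    exact: lexx.
  by apply: (integrable_fin_num _ iRe); exact: measurable_TBX.
Qed.

Lemma cabs_double_le (r C N : R) (x y : R[i]) : 0 <= r ->
  cabs x <= 2 * complex.Re y -> cabs (r%:C * y) <= C * N ->
  cabs (r%:C * x) <= 2 * C * N.
Proof.
move=> r0 xy; rewrite !cabs_realM// -mulrA => yN.
apply: (@le_trans _ _ (r * (2 * cabs y))); last by rewrite mulrCA ler_pM2l.
apply: ler_wpM2l => //; apply: (le_trans xy); rewrite ler_pM2l//.
exact: (le_trans (ler_norm _) (Re_le_cabs _)).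
Qed.

Lemma S_bounded_T_bounded k (p1 al1 al2 a1 a2 b1 b2 c1 c2 : R) :
  @S_bounded R k.+1 p1 al1 al2 a1 a2 b1 b2 c1 c2 ->
  @T_bounded R k.+1 p1 al1 al2 a1 a2 b1 b2 c1 c2.
Proof.
move=> [C HC]; exists (2 * C) => f mf foo.
pose g : T k * T k -> R[i] := fun ue => (cabs (f ue))%:C.
have mg : cmeasurable g by split => /=; [exact: measurable_cabs|exact: measurable_cst].
have ge ue : cabs (g ue) = cabs (f ue) by rewrite cabs_real// cabs_ge0.
have gf : mixed_norm_p_infty p1 al1 al2 g = mixed_norm_p_infty p1 al1 al2 f.
  by apply: eq_mixed_norm; apply/funext => ue; exact: ge.
have goo : (mixed_norm_p_infty p1 al1 al2 g < +oo)%E by rewrite gf.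
have [conv bnd] := HC g mg goo.
have fE := mixed_norm_fineE foo.
set N := fine _ in fE.
have key := @Tkernel_dominated k b1 b2 c1 c2 f mf.
clear HC mg ge goo.
split.
  by apply: filterS conv => -[z w] h zw; have /= [] := key z w zw.1 zw.2 (h zw).
apply: filterS2 conv bnd => -[z w] h1 h2 zw.
have [_ h3] := key z w zw.1 zw.2 (h1 zw).
have := h2 zw; rewrite gf fE -!EFinM !lee_fin /Top /Sop.
apply: cabs_double_le h3.
by apply: mulr_ge0; exact: powR_ge0.
Qed.

End Implications.

(** * Series and almost-everywhere lemmas *)

Section SeriesAux.
Variable R : realType.

Lemma eseries_harmonic (a : R) : 0 < a ->
  (\sum_(0 <= j <oo) (a / j.+1%:R)%:E = +oo)%E.
Proof.
move=> a0; under eq_eseriesr do rewrite EFinM.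
rewrite nneseriesZl; last by move=> j _; rewrite lee_fin invr_ge0.
suff -> : (\sum_(0 <= j <oo) (j.+1%:R^-1 : R)%:E = +oo)%E by rewrite gt0_muley.
apply/eqP; apply: contraPT (@dvg_harmonic R) => noo; apply.
have s0 (j : nat) : xpredT j -> (0 <= (j.+1%:R^-1 : R)%:E)%E by rewrite lee_fin invr_ge0.
have : cvgn (fun n => \sum_(0 <= j < n) (j.+1%:R^-1 : R)%:E)%E.
  by apply: is_cvg_nneseries => *; exact: s0.
have fin : (\sum_(0 <= j <oo) (j.+1%:R^-1 : R)%:E \is a fin_num)%E.
  by rewrite ge0_fin_numE ?ltey// nneseries_ge0.
move=> c; have : (fun n => \sum_(0 <= j < n) (j.+1%:R^-1 : R)%:E)%E @ \oo -->
   (fine (\sum_(0 <= j <oo) (j.+1%:R^-1 : R)%:E)%E)%:E.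
  by rewrite fineK.
move/fine_cvg => h; apply/cvg_ex; exists (fine (\sum_(0 <= j <oo) (j.+1%:R^-1 : R)%:E)%E).
apply: cvg_trans h; apply: near_eq_cvg; apply: nearW => n.
by rewrite /= sumEFin.
Qed.

(** For [x = j + 2] one has [(1 - 1/x)^(-s) >= exp(s/x) >= 1 + s/x]. This replaces the comparison of
    the Riemann series with an integral by a telescoping sum. *)
Lemma riemann_telescope (s : R) (j : nat) : 0 < s ->
  s * j.+2%:R `^ (- (1 + s)) <= j.+1%:R `^ (- s) - j.+2%:R `^ (- s).
Proof.
move=> s0; set x : R := j.+2%:R.
have x0 : 0 < x by rewrite ltr0n.
have y0 : 0 < j.+1%:R :> R by rewrite ltr0n.
have yE : j.+1%:R = x - 1 :> R by rewrite /x -[in RHS](natr1 j.+1) addrK.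
have b : x `^ (- s) * (1 + s / x) <= j.+1%:R `^ (- s).
  have -> : j.+1%:R = x * (1 - x^-1) :> R by rewrite mulrBr mulr1 divff ?gt_eqF// yE.
  have z0 : 0 < 1 - x^-1.
    by rewrite subr_gt0 invf_lt1// ltr1n.
  rewrite (powRM _ (ltW x0) (ltW z0)); apply: ler_wpM2l; first exact: powR_ge0.
  rewrite /powR gt_eqF//; apply: (le_trans _ (expR_ge1Dx _)).
  rewrite lerD2l mulNr -mulrN ler_pM2l// lerNr.
  by apply: le_ln1Dx; rewrite ltrN2 invf_lt1// ltr1n.
have -> : x `^ (- (1 + s)) = x^-1 * x `^ (- s).
  by rewrite opprD powRD ?(gt_eqF x0) ?implybT// powR_inv1 ?ltW.
move: b; move: (x `^ (- s)) (x^-1) (j.+1%:R `^ (- s)) => u v t h; lra.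
Qed.

Lemma eseries_riemann (p : R) : 1 < p ->
  (\sum_(0 <= j <oo) (j.+1%:R `^ (- p))%:E < +oo)%E.
Proof.
move=> p1; pose s := p - 1; have s0 : 0 < s by rewrite subr_gt0.
have pE : p = 1 + s by rewrite /s; ring.
have part n : \sum_(0 <= j < n.+1) (j.+1%:R `^ (- p)) <=
    1 + s^-1 * (1 - n.+1%:R `^ (- s)).
  elim: n => [|n IH]; first by rewrite big_nat1 powR1 subrr mulr0 addr0.
  rewrite big_nat_recr//=; apply: (le_trans (lerD IH (lexx _))).
  have := riemann_telescope n s0; rewrite -pE.
  rewrite -(ler_pM2l (x := s^-1)) ?invr_gt0// mulKf ?gt_eqF//.
  by move: (n.+2%:R `^ (- p)) (n.+1%:R `^ (- s)) (n.+2%:R `^ (- s)) (s^-1) => a b c e h; lra.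
apply: (@le_lt_trans _ _ (1 + s^-1)%:E); last exact: ltry.
apply: lime_le; first by apply: is_cvg_nneseries => *; rewrite lee_fin powR_ge0.
apply: nearW => -[|n]; first by rewrite big_nil lee_fin addr_ge0// invr_ge0 ltW.
rewrite sumEFin lee_fin (le_trans (part n))// lerD2l ler_piMr ?invr_ge0 ?(ltW s0)//.
Qed.

(** For [e] nonzero of either sign, the base [(|C| + 1) ^ (1 / e)] gives the value [|C| + 1]. *)
Lemma powR_bounded_eq0 (e C : R) : (forall H : R, 0 < H -> H `^ e <= C) -> e = 0.
Proof.
move=> h; apply/eqP/negPn/negP => e0.
have C0 : 0 < `|C| + 1 by rewrite ltr_wpDl.
have := h ((`|C| + 1) `^ e^-1); rewrite powR_gt0// => /(_ isT).
rewrite -powRrM mulVf// (powRr1 (ltW C0)) => h1.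
have := ler_norm C; lra.
Qed.

End SeriesAux.

Section MeasureAux.
Context d (T : measurableType d) (R : realType).
Variable mu : {measure set T -> \bar R}.

Lemma ae_exists (P : T -> Prop) (A : set T) :
  measurable A -> mu A <> 0%E -> {ae mu, forall x, P x} -> exists x, A x /\ P x.
Proof.
move=> mA A0 h; apply: contrapT => nex; apply: A0.
apply: measure_negligible => //; apply: negligibleS h => x Ax /= Px.
by apply: nex; exists x.
Qed.

Lemma eseries_disjoint (Q : nat -> set T) (c : nat -> R) (j : nat) (u : T) :
  trivIset setT Q -> (forall i, 0 <= c i) -> Q j u ->
  (\sum_(0 <= i <oo) (c i * \1_(Q i) u)%:E = (c j)%:E)%E.
Proof.
move=> tQ c0 Qu; rewrite (nneseriesD1 (n := j))//; last first.
  by move=> i _; rewrite lee_fin mulr_ge0.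
rewrite indicE mem_set// mulr1 eseries0 ?adde0// => i _ /= ij.
rewrite indicE memNset ?mulr0// => Qi.
move/eqP: ij; apply; apply: tQ => //; by exists u.
Qed.

Lemma eseries_outside (Q : nat -> set T) (c : nat -> R) (u : T) :
  (forall i, ~ Q i u) -> (\sum_(0 <= i <oo) (c i * \1_(Q i) u)%:E = 0)%E.
Proof.
by move=> nQ; rewrite eseries0// => i _ _; rewrite indicE memNset ?mulr0.
Qed.

End MeasureAux.

(** * Test functions *)

Section TestBoxes.
Variable R : realType.
Local Notation T k := (projT2 (Cspace R k.+1)).

Lemma nearC_le k (z u : CN R k.+1) (L L' : R) : L <= L' -> nearC z u L -> nearC z u L'.
Proof.
move=> LL; elim: k z u => [//|k IH] z u.
rewrite !nearC_step => /and3P[h1 h2 h3].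
by rewrite (le_trans h1 LL) (le_trans h2 LL) IH.
Qed.

(* The centre of the box plays no role, any point would do. *)
Definition tbox k (D M H : R) : set (T k) :=
  box (point : T k) (Num.sqrt D) M 0 0 H (4 * H).

Lemma measurable_tbox k (D M H : R) : measurable (@tbox k D M H).
Proof. exact: measurable_box. Qed.

Lemma tbox_measure k (D M H : R) : 0 <= D -> 0 <= M -> 0 <= H ->
  lebC R k.+1 (@tbox k D M H) = ((4 * D) ^+ k * M * (3 * H))%:E.
Proof.
move=> D0 M0 H0; have H4 : H <= 4 * H by lra.
rewrite /tbox (box_measure _ _ _ (sqrtr_ge0 _) M0 H4) exprM (exprMn 2) sqr_sqrtr//.
by congr (_%:E); congr (_ ^+ _ * _ * _); ring.
Qed.

Lemma tbox_sub_TB k (D M H : R) : 0 <= H -> @tbox k D M H `<=` @TB R k.+1.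
Proof. by move=> H0; exact: box_sub_TB. Qed.

Lemma tbox_rho k (D M H : R) u : @tbox k D M H u -> H < rho u <= 4 * H.
Proof. by case=> _ [_]; rewrite subr0. Qed.

(** All these boxes share one centre, so [nearC_qdist] and [nearC_im4] apply with that centre as
    [z0] once both widths are enlarged to [Num.sqrt E]. *)
Lemma tbox_re4_im4 k (D M H D' M' H' E : R) z u :
  @tbox k D M H z -> @tbox k D' M' H' u -> 0 <= H -> 0 <= H' ->
  0 <= E -> D <= E -> D' <= E ->
  [/\ 2 * (H + H') <= re4 z u, re4 z u <= 8 * (H + H') + 8 * k%:R * E &
      `|im4 z u| <= M + M' + 4 * k%:R * E].
Proof.
move=> tz tu H0 H0' E0 DE DE'.
have /andP[rz1 rz2] := tbox_rho tz; have /andP[ru1 ru2] := tbox_rho tu.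
case: tz => nz [iz _]; case: tu => nu [iu _]; rewrite !add0r in iz iu.
have {}nz := nearC_le (ler_wsqrtr DE) nz.
have {}nu := nearC_le (ler_wsqrtr DE') nu.
have := nearC_qdist nz nu; have := nearC_im4 nz nu; rewrite sqr_sqrtr//.
have q0 := qdist_ge0 z u; rewrite re4E => hi hq.
have hi' : `|im4 z u| <= M + M' + 4 * k%:R * E.
  rewrite (_ : im4 z u = (im4 z u - im4 point u + im4 point z) + im4 point u - im4 point z); last by ring.
  apply: (le_trans (ler_normB _ _)); apply: (le_trans (lerD (ler_normD _ _) (lexx _))).
  by move: (k%:R * E) iz iu hi => *; lra.
split => //.
  by move: (rho z) (rho u) (qdist z u) rz1 ru1 q0; clear => *; lra.
by move: (rho z) (rho u) (qdist z u) rz2 ru2 hq; clear => *; lra.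
Qed.

Lemma tbox_cabs k (D M H D' M' H' E : R) z u :
  @tbox k D M H z -> @tbox k D' M' H' u -> 0 <= H -> 0 <= H' ->
  0 <= E -> D <= E -> D' <= E ->
  H + H' <= 2 * cabs (rho2 z u) /\
  4 * cabs (rho2 z u) <= 8 * (H + H') + M + M' + 12 * k%:R * E.
Proof.
move=> tz tu H0 H0' E0 DE DE'.
have [h1 h2 h3] := tbox_re4_im4 tz tu H0 H0' E0 DE DE'.
have h4 := re4_cabs z u; have h5 := cabs_re4_im4 z u.
have re0 : 0 <= re4 z u by apply: (le_trans _ h1); rewrite mulr_ge0 ?addr_ge0.
rewrite (ger0_norm re0) in h5.
move: (re4 z u) `|im4 z u| (cabs _) (k%:R * E) h1 h2 h3 h4 h5 => *; split; lra.
Qed.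

End TestBoxes.

Section ProductTest.
Variable R : realType.
Local Notation T k := (projT2 (Cspace R k.+1)).
Local Open Scope complex_scope.

Definition prodtest k (f1 f2 : T k -> R) (ue : T k * T k) : R[i] :=
  (f1 ue.1 * f2 ue.2)%:C.

Lemma prodtest_cmeasurable k (f1 f2 : T k -> R) :
  measurable_fun setT f1 -> measurable_fun setT f2 -> cmeasurable (prodtest f1 f2).
Proof.
move=> m1 m2; split => /=; last exact: measurable_cst.
apply: measurable_funM.
  by apply: (measurableT_comp m1); exact: measurable_fst.
by apply: (measurableT_comp m2); exact: measurable_snd.
Qed.

(** As [f2] is at most 1, the bound holds on every slice and the exceptional set can be empty. *)
Lemma mixed_norm_prodtest k (p1 al1 al2 m : R) (f1 f2 : T k -> R) : 0 < p1 ->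
  measurable_fun setT f1 -> (forall u, 0 <= f1 u) -> (forall u, 0 <= f2 u <= 1) ->
  (\int[lebC R k.+1]_(u in @TB R k.+1) (f1 u `^ p1 * rho u `^ al1)%:E <= m%:E)%E ->
  (mixed_norm_p_infty p1 al1 al2 (prodtest f1 f2) <= (m `^ p1^-1)%:E)%E.
Proof.
move=> p0 mf1 f10 f21 hm; apply: ereal_inf_lbound.
exists set0; split; first exact: measurable0.
split; first by rewrite set0I integral_set0.
move=> w _ _; have /andP[w0 w1] := f21 w.
have mr : measurable_fun [set: T k] (fun u => rho u `^ al1).
  by apply: (measurableT_comp (measurable_powR _)); exact: measurable_rho.
have le1 : (\int[lebC R k.+1]_(z in @TB R k.+1)
   (cabs (prodtest f1 f2 (z, w)) `^ p1 * rho z `^ al1)%:E <= m%:E)%E.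
  apply: le_trans hm; apply: ge0_le_integral.
  - exact: measurable_TB.
  - by move=> z _; rewrite lee_fin mulr_ge0 ?powR_ge0.
  - apply: measurable_funTS; apply/measurable_EFinP; apply: measurable_funM => //.
    apply: (measurableT_comp (measurable_powR _)).
    rewrite (_ : (fun z => _) = fun z => f1 z * f2 w); first exact: measurable_funM.
    by apply/funext => z; rewrite cabs_real// mulr_ge0.
  - apply: measurable_funTS; apply/measurable_EFinP; apply: measurable_funM => //.
    by apply: (measurableT_comp (measurable_powR _)).
  move=> z _; rewrite lee_fin ler_wpM2r ?powR_ge0// cabs_real ?mulr_ge0//=.
  apply: ge0_ler_powR; rewrite ?nnegrE ?mulr_ge0//; first exact: ltW.
  by rewrite ler_piMr.
have m0 : (0 <= m%:E)%E.
  by apply: le_trans le1; apply: integral_ge0 => u _; rewrite lee_fin mulr_ge0 ?powR_ge0.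
rewrite -poweR_EFin; apply: gt0_ler_poweR => //.
- by rewrite invr_ge0 ltW.
- rewrite in_itv /= leey andbT; apply: integral_ge0 => u _.
  by rewrite lee_fin mulr_ge0 ?powR_ge0.
- by rewrite in_itv /= leey andbT.
Qed.

Lemma dV2X k (A B : set (T k)) : measurable A -> measurable B ->
  @dV2 R k.+1 (A `*` B) = (lebC R k.+1 A * lebC R k.+1 B)%E.
Proof. by move=> mA mB; exact: product_measure1E. Qed.

(** Continuity of [cos] and [atan] at 0. In the application [t1] and [t2] are the ratios of [im4] to
    [re4] in the two variables. *)
Lemma small_phase (c1 c2 : R) : exists e : R, [/\ 0 < e, e <= 1 &
  forall t1 t2, `|t1| <= e -> `|t2| <= e -> 2^-1 <= cos (c1 * atan t1 + c2 * atan t2)].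
Proof.
have [d d0 hd] : exists2 d : R, 0 < d & forall x, `|x| < d -> 2^-1 <= cos x.
  have /cvgrPdist_lt/(_ 2^-1) := @continuous_cos R 0.
  rewrite invr_gt0 ltr0n => /(_ isT)/nbhs_ballP[d /= d0 hd]; exists d => // x xd.
  have := hd x; rewrite /ball /= sub0r normrN => /(_ xd); rewrite cos0.
  by move/ltr_normlW; lra.
have small (c : R) : exists2 e : R, 0 < e & forall t, `|t| < e -> `|c * atan t| < d / 2.
  have : (fun t => c * atan t) @ (0 : R) --> c * atan 0.
    by apply: cvgMr; exact: continuous_atan.
  rewrite atan0 mulr0 => /cvgrPdist_lt/(_ (d / 2)); rewrite divr_gt0// => /(_ isT).
  move/nbhs_ballP=> [e /= e0 he]; exists e => // t te.
  have := he t; rewrite /ball /= sub0r normrN => /(_ te).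
  by rewrite sub0r normrN.
have [e1 e10 h1] := small c1; have [e2 e20 h2] := small c2.
pose e := Num.min 1 (Num.min (e1 / 2) (e2 / 2)).
have e1' : e < e1 by rewrite !gt_min; apply/orP; right; apply/orP; left; lra.
have e2' : e < e2 by rewrite !gt_min; apply/orP; right; apply/orP; right; lra.
exists e; split.
- by rewrite !lt_min ltr01 /= !divr_gt0.
- by rewrite ge_min lexx.
move=> t1 t2 ht1 ht2; apply: hd; apply: (le_lt_trans (ler_normD _ _)).
have := h1 t1 (le_lt_trans ht1 e1'); have := h2 t2 (le_lt_trans ht2 e2').
lra.
Qed.

Lemma kern_lower k (b c K H D : R) (z u : CN R k.+1) :
  1 <= K -> 0 < H -> 0 < D -> H / K <= rho u <= K * H ->
  D / K <= cabs (rho2 z u) <= K * D ->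
  K `^ (- `|b|) * K `^ (- `|c|) * (H `^ b * D `^ (- c)) <= kern b c z u.
Proof.
move=> K1 H0 D0 h1 h2; rewrite /kern -powRN mulrACA.
have /andP[l1 _] := powR_comparable b K1 H0 h1.
have /andP[l2 _] := powR_comparable (- c) K1 D0 h2.
by rewrite normrN in l2; apply: ler_pM => //; rewrite mulr_ge0 ?powR_ge0.
Qed.

End ProductTest.

(** * Scaling: the two equalities *)

Section Scaling.
Variable R : realType.
Local Notation T k := (projT2 (Cspace R k.+1)).
Local Open Scope complex_scope.

(** For both families of boxes [tbox_cabs] gives at most [3 * k + 9/2] times the scale; 5 in place
    of 9/2 also covers the ratio 4 of the heights. *)
Definition bconst (k : nat) : R := 3 * k%:R + 5.

Lemma bconst_ge1 k : 1 <= bconst k.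
Proof. by have := ler0n R k; rewrite /bconst; lra. Qed.

(** Widths scale like [sqrt H] and heights like [H], as under the dilations of the tube. The factor
    [e] makes [im4] small against [re4], which is at least [4 * H] for two points of the box. *)
Definition sbox k (e H : R) : set (T k) := @tbox R k (e * H) (e * H) H.

Lemma sbox_bounds_aux (k H e a b r : R) : 0 <= k -> 0 < H -> 0 < e -> e <= 1 ->
  H < r <= 4 * H ->
  H + H <= 2 * a -> 4 * a <= 8 * (H + H) + e * H + e * H + 12 * k * (e * H) ->
  (H / (3 * k + 5) <= r <= (3 * k + 5) * H) /\
  (H / (3 * k + 5) <= a <= (3 * k + 5) * H).
Proof.
move=> k0 H0 e0 e1 /andP[r1 r2] a1 a2.
have eH : e * H <= H by rewrite ler_piMl// ltW.
have keH : k * (e * H) <= k * H by rewrite ler_wpM2l.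
have kH : 0 <= k * H by rewrite mulr_ge0// ltW.
have HK : H / (3 * k + 5) <= H.
  by rewrite ler_pdivrMr; [rewrite ler_peMr; lra|lra].
have a1' : H <= a by lra.
split; apply/andP; split.
- by apply: (le_trans HK); exact: ltW.
- by lra.
- exact: (le_trans HK).
- by lra.
Qed.

Lemma sbox_bounds k (e H : R) z u : 0 < e -> e <= 1 -> 0 < H ->
  @sbox k e H z -> @sbox k e H u ->
  (H / bconst k <= rho u <= bconst k * H) /\
  (H / bconst k <= cabs (rho2 z u) <= bconst k * H).
Proof.
move=> e0 e1 H0 tz tu.
have eH : 0 <= e * H by rewrite mulr_ge0 ?ltW.
have [h1 h2] := tbox_cabs tz tu (ltW H0) (ltW H0) eH (lexx _) (lexx _).
exact: sbox_bounds_aux (ler0n _ _) H0 e0 e1 (tbox_rho tu) h1 h2.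
Qed.

Lemma ratio_le_aux (k H e x y : R) : 0 <= k -> 0 < H -> 0 < e ->
  2 * (H + H) <= x -> `|y| <= e * H + e * H + 4 * k * (e * H) ->
  `|y * x `^ (-1)| <= (k + 1) * e.
Proof.
move=> k0 H0 e0 hx hy; have x0 : 0 < x by lra.
rewrite (powR_inv1 (ltW x0)) normrM normfV (gtr0_norm x0) ler_pdivrMr//.
apply: (le_trans hy); apply: (@le_trans _ _ ((k + 1) * e * (2 * (H + H)))).
  have : 0 <= e * H by rewrite mulr_ge0 ?ltW.
  have -> : (k + 1) * e * (2 * (H + H)) = 4 * k * (e * H) + 4 * (e * H) by ring.
  by move: (e * H) (4 * k * (e * H)) => eH keH; lra.
by apply: ler_wpM2l => //; apply: mulr_ge0; [lra|exact: ltW].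
Qed.

Lemma sbox_ratio k (e H : R) z u : 0 < e -> e <= 1 -> 0 < H ->
  @sbox k e H z -> @sbox k e H u -> `|im4 z u * re4 z u `^ (-1)| <= k.+1%:R * e.
Proof.
move=> e0 e1 H0 tz tu.
have eH : 0 <= e * H by rewrite mulr_ge0 ?ltW.
have [h1 _ h3] := tbox_re4_im4 tz tu (ltW H0) (ltW H0) eH (lexx _) (lexx _).
rewrite -(natr1 k); exact: ratio_le_aux (ler0n _ _) H0 e0 h1 h3.
Qed.

Lemma sbox_measure k (e H : R) : 0 <= e -> 0 < H ->
  lebC R k.+1 (@sbox k e H) = (3 * (4 * e) ^+ k * e * H `^ k.+2%:R)%:E.
Proof.
move=> e0 H0; have eH : 0 <= e * H := mulr_ge0 e0 (ltW H0).
rewrite /sbox (tbox_measure _ eH eH (ltW H0)) (powR_mulrn _ (ltW H0)).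
have -> : (4 * (e * H)) ^+ k = (4 * e) ^+ k * H ^+ k by rewrite mulrA exprMn.
rewrite !(exprS H).
by congr (_%:E); move: ((4 * e) ^+ k) (H ^+ k) => a b; ring.
Qed.

(** The cosine of the phase stays positive on the support of [f], so no cancellation occurs in the
    real part. *)
Lemma Re_cint_lower k (b1 b2 c1 c2 : R) (Q1 Q2 : set (T k)) (dk m1 m2 : R) z w :
  measurable Q1 -> measurable Q2 -> Q1 `<=` @TB R k.+1 -> Q2 `<=` @TB R k.+1 ->
  0 <= dk -> lebC R k.+1 Q1 = m1%:E -> lebC R k.+1 Q2 = m2%:E ->
  (forall ue, Q1 ue.1 -> Q2 ue.2 ->
    dk <= dkern b1 b2 c1 c2 z w ue /\ 2^-1 <= cos (phase c1 c2 z w ue)) ->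
  let f := prodtest (\1_Q1) (\1_Q2) in
  let D : set (T k * T k) := @TB R k.+1 `*` @TB R k.+1 in
  cintegrable (@dV2 R k.+1) D (Tkernel b1 b2 c1 c2 f z w) ->
  dk * 2^-1 * (m1 * m2) <=
  complex.Re (cint (@dV2 R k.+1) D (Tkernel b1 b2 c1 c2 f z w)).
Proof.
move=> mQ1 mQ2 sQ1 sQ2 dk0 e1 e2 hQ f D [iRe _].
have mD : measurable D by exact: measurable_TBX.
have mQ : measurable (Q1 `*` Q2) by exact: measurableX.
have fE x : complex.Re (Tkernel b1 b2 c1 c2 f z w x) =
    dkern b1 b2 c1 c2 z w x * (cos (phase c1 c2 z w x) * \1_(Q1 `*` Q2) x).
  rewrite TkernelE Re_realM /f /prodtest /=; congr (_ * _).
  by rewrite mulr0 subr0; congr (_ * _); rewrite !indicE in_setX -natrM mulnb.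
move: iRe fE; move: (Tkernel b1 b2 c1 c2 f z w) => g iRe fE.
rewrite /= -lee_fin fineK; last by apply: (integrable_fin_num mD iRe).
have dk2 : 0 <= dk * 2^-1 by rewrite mulr_ge0// invr_ge0.
have -> : (dk * 2^-1 * (m1 * m2))%:E =
   (\int[@dV2 R k.+1]_(x in D) (dk * 2^-1 * \1_(Q1 `*` Q2) x)%:E)%E.
  under eq_integral do rewrite EFinM.
  rewrite ge0_integralZl_EFin//; last first.
    by apply/measurable_EFinP; apply: measurable_funTS; exact: measurable_indic.
  rewrite integral_indic// (_ : Q1 `*` Q2 `&` D = Q1 `*` Q2); last first.
    by apply/setIidl => -[x y] [/= h1 h2]; split; [exact: sQ1|exact: sQ2].
  have dVE : @dV2 R k.+1 (Q1 `*` Q2) = (m1 * m2)%:E by rewrite dV2X// e1 e2 -EFinM.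
  by rewrite EFinM; congr (_ * _)%E; exact: esym dVE.
apply: ge0_le_integral => //.
- by move=> x _; rewrite lee_fin mulr_ge0.
- apply/measurable_EFinP; apply: measurable_funTS.
  by apply: measurable_funM; [exact: measurable_cst|exact: measurable_indic].
- exact: measurable_int iRe.
move=> x _; rewrite fE lee_fin indicE; have [|_] := boolP (x \in Q1 `*` Q2); last first.
  by rewrite !mulr0.
rewrite inE => -[q1 q2]; have [h1 h2] := hQ x q1 q2.
by rewrite !mulr1; apply: ler_pM => //; rewrite invr_ge0.
Qed.

End Scaling.

(** * Thin boxes as test sets *)

Section Equalities.
Variable R : realType.
Local Notation T k := (projT2 (Cspace R k.+1)).
Local Open Scope complex_scope.

(** Convergence and bound hold almost everywhere, hence simultaneously at some point of any product
    of positive measure, in particular inside the support of a test function. The absolute value of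
    [C] allows the norm to be replaced by an upper bound [N]. *)
Lemma bounded_point k (p1 al1 al2 : R) conv Op :
  @bounded_to_Linfty R k.+1 p1 al1 al2 conv Op ->
  exists C : R, forall (f : T k * T k -> R[i]) (N : R) (Q1 Q2 : set (T k)),
    cmeasurable f -> (mixed_norm_p_infty p1 al1 al2 f <= N%:E)%E ->
    measurable Q1 -> measurable Q2 -> lebC R k.+1 Q1 <> 0%E -> lebC R k.+1 Q2 <> 0%E ->
    Q1 `<=` @TB R k.+1 -> Q2 `<=` @TB R k.+1 ->
    exists z w : CN R k.+1,
      [/\ Q1 z, Q2 w, conv f (z, w) & cabs (Op f (z, w)) <= C * N].
Proof.
move=> [C HC]; exists `|C| => f N Q1 Q2 mf fN mQ1 mQ2 n1 n2 s1 s2.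
have foo : (mixed_norm_p_infty p1 al1 al2 f < +oo)%E by apply: (le_lt_trans fN); exact: ltry.
have [h1 h2] := HC f mf foo; clear HC.
have mQ : measurable (Q1 `*` Q2) by exact: measurableX.
have nQ : @dV2 R k.+1 (Q1 `*` Q2) <> 0%E.
  by rewrite dV2X//; move/eqP; rewrite mule_eq0 => /orP[] /eqP.
have [[z w] [[/= q1 q2] [/= i1 i2]]] := ae_exists mQ nQ (filterI h1 h2).
have TBzw : (@TB R k.+1 `*` @TB R k.+1) (z, w) by split; [exact: s1|exact: s2].
exists z, w; split; [exact: q1|exact: q2|exact: i1|].
have := i2 TBzw; clear i1 i2 h1 h2.
have := mixed_norm_ge0 p1 al1 al2 f; move: fN; rewrite (mixed_norm_fineE foo).
move: (fine _) => F; rewrite -EFinM !lee_fin => FN F0 h.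
apply: (le_trans h); apply: (@le_trans _ _ (`|C| * F)).
  by apply: ler_wpM2r => //; exact: ler_norm.
by apply: ler_wpM2l.
Qed.

Lemma indic_weight_le k (p1 al1 c m : R) (Q : set (T k)) : 0 < p1 ->
  measurable Q -> 0 <= c -> (forall u, Q u -> rho u `^ al1 <= c) ->
  (lebC R k.+1 Q <= m%:E)%E ->
  (\int[lebC R k.+1]_(u in @TB R k.+1) ((\1_Q u : R) `^ p1 * rho u `^ al1)%:E <= (c * m)%:E)%E.
Proof.
move=> p0 mQ c0 Qc Qm; apply: le_trans (integral_scaled_indic (measurable_TB (k := k)) mQ c0 Qm).
apply: ge0_le_integral.
- exact: measurable_TB.
- by move=> u _; rewrite lee_fin mulr_ge0 ?powR_ge0.
- apply: measurable_funTS; apply/measurable_EFinP; apply: measurable_funM.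
    by apply: (measurableT_comp (measurable_powR _)); exact: measurable_indic.
  by apply: (measurableT_comp (measurable_powR _)); exact: measurable_rho.
- apply: measurable_funTS; apply/measurable_EFinP.
  by apply: measurable_funM; [exact: measurable_cst|exact: measurable_indic].
move=> u _; rewrite lee_fin indicE; have [|_] := boolP (u \in Q).
  by rewrite inE => /Qc; rewrite powR1 mul1r mulr1.
by rewrite powR0 ?gt_eqF// mul0r mulr0.
Qed.

(** Up to powers of [K], both [rho] and the modulus of [rho2] equal [H1] or [H2] on the boxes, and
    the volumes are of order [H ^ (n + 1)]. [H2] is absent on the right because the norm in the
    second variable is a supremum. *)
Lemma T_bounded_scaling k (p1 al1 al2 a1 a2 b1 b2 c1 c2 : R) : 1 < p1 ->
  @T_bounded R k.+1 p1 al1 al2 a1 a2 b1 b2 c1 c2 ->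
  exists C : R, forall H1 H2 : R, 0 < H1 -> 0 < H2 ->
   H1 `^ (a1 + b1 - c1 + k.+2%:R) * H2 `^ (a2 + b2 - c2 + k.+2%:R) <=
   C * H1 `^ ((k.+2%:R + al1) / p1).
Proof.
move=> p11 /bounded_point[C HC].
have p0 : 0 < p1 by lra.
have [e' [e'0 e'1 he']] := small_phase c1 c2.
have k0 : 0 < k.+1%:R :> R by rewrite ltr0n.
(* [sbox_ratio] loses a factor [k.+1]. *)
pose e := e' / k.+1%:R.
have e0 : 0 < e by rewrite divr_gt0.
have e1 : e <= 1.
  by rewrite ler_pdivrMr// mul1r (le_trans e'1)// ler1n.
pose K := bconst R k; have K1 : 1 <= K by exact: bconst_ge1.
have K0 : 0 < K by lra.
have [m0 [m00 mE]] : exists m0 : R, 0 < m0 /\ forall H : R, 0 < H ->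
    lebC R k.+1 (@sbox R k e H) = (m0 * H `^ k.+2%:R)%:E.
  exists (3 * (4 * e) ^+ k * e); split => [|H H0]; last exact: sbox_measure (ltW e0) H0.
  by rewrite !mulr_gt0 ?exprn_gt0 ?mulr_gt0.
(* [A] collects the constants of the lower bound: outer weights, the two kernels, the cosine and the
   two volumes. [B] is the constant of the norm. *)
pose A := (K `^ (- `|a1|) * K `^ (- `|a2|)) *
  ((K `^ (- `|b1|) * K `^ (- `|c1|)) * (K `^ (- `|b2|) * K `^ (- `|c2|)) * 2^-1 * (m0 * m0)).
have half0 : 0 < 2^-1 :> R by rewrite invr_gt0 ltr0n.
have A0 : 0 < A by rewrite !mulr_gt0 ?powR_gt0.
pose B := (K `^ `|al1| * m0) `^ p1^-1.
exists (C * B / A) => H1 H2 H10 H20.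
pose Q1 := @sbox R k e H1; pose Q2 := @sbox R k e H2.
have mQ1 : measurable Q1 by exact: measurable_tbox.
have mQ2 : measurable Q2 by exact: measurable_tbox.
have sQ1 : Q1 `<=` @TB R k.+1 by apply: tbox_sub_TB; exact: ltW.
have sQ2 : Q2 `<=` @TB R k.+1 by apply: tbox_sub_TB; exact: ltW.
have E1 : lebC R k.+1 Q1 = (m0 * H1 `^ k.+2%:R)%:E by exact: mE.
have E2 : lebC R k.+1 Q2 = (m0 * H2 `^ k.+2%:R)%:E by exact: mE.
have n1 : lebC R k.+1 Q1 <> 0%E.
  by rewrite E1 => -[] /eqP; rewrite gt_eqF// mulr_gt0 ?powR_gt0.
have n2 : lebC R k.+1 Q2 <> 0%E.
  by rewrite E2 => -[] /eqP; rewrite gt_eqF// mulr_gt0 ?powR_gt0.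
have rc (al H : R) z : 0 < H -> @sbox R k e H z ->
    K `^ (- `|al|) * H `^ al <= rho z `^ al <= K `^ `|al| * H `^ al.
  move=> H0 q; have [hr _] := sbox_bounds e0 e1 H0 q q.
  exact: powR_comparable.
pose N := (K `^ `|al1| * H1 `^ al1 * (m0 * H1 `^ k.+2%:R)) `^ p1^-1.
have fN : (mixed_norm_p_infty p1 al1 al2 (prodtest (\1_Q1) (\1_Q2)) <= N%:E)%E.
  apply: mixed_norm_prodtest => //.
  - by move=> u; rewrite indicE; case: (_ \in _); rewrite /= ?lexx ?ler01.
  - apply: indic_weight_le => //; first by rewrite mulr_ge0 ?powR_ge0.
      by move=> u q; have /andP[] := rc al1 H1 u H10 q.
    by rewrite E1.
have mf : cmeasurable (prodtest (\1_Q1 : T k -> R) (\1_Q2)).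
  by apply: prodtest_cmeasurable; exact: measurable_indic.
have [z [w [q1 q2 /= conv bnd]]] := HC _ _ _ _ mf fN mQ1 mQ2 n1 n2 sQ1 sQ2.
pose dk := (K `^ (- `|b1|) * K `^ (- `|c1|) * (H1 `^ b1 * H1 `^ (- c1))) *
   (K `^ (- `|b2|) * K `^ (- `|c2|) * (H2 `^ b2 * H2 `^ (- c2))).
have dk0 : 0 <= dk by rewrite !mulr_ge0 ?powR_ge0.
have hQ (ue : T k * T k) : Q1 ue.1 -> Q2 ue.2 ->
    dk <= dkern b1 b2 c1 c2 z w ue /\ 2^-1 <= cos (phase c1 c2 z w ue).
  move=> u1 u2; split.
    have [g1 g2] := sbox_bounds e0 e1 H10 q1 u1.
    have [g3 g4] := sbox_bounds e0 e1 H20 q2 u2.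
    apply: ler_pM; rewrite ?mulr_ge0 ?powR_ge0//; exact: kern_lower.
  rewrite /phase (carg_TB (sQ1 _ q1) (sQ1 _ u1)) (carg_TB (sQ2 _ q2) (sQ2 _ u2)).
  have ee : k.+1%:R * e = e' by rewrite mulrC divfK// gt_eqF.
  by apply: he'; rewrite -ee; [exact: (sbox_ratio e0 e1 H10)|exact: (sbox_ratio e0 e1 H20)].
have low := Re_cint_lower mQ1 mQ2 sQ1 sQ2 dk0 E1 E2 hQ conv.
have final : rho z `^ a1 * rho w `^ a2 *
   (dk * 2^-1 * (m0 * H1 `^ k.+2%:R * (m0 * H2 `^ k.+2%:R))) <= C * N.
  apply: le_trans bnd; rewrite /Top cabs_realM; last by rewrite mulr_ge0 ?powR_ge0.
  apply: ler_wpM2l; first by rewrite mulr_ge0 ?powR_ge0.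
  by apply: (le_trans low); apply: (le_trans (ler_norm _)); exact: Re_le_cabs.
have /andP[ra1 _] := rc a1 H1 z H10 q1.
have /andP[ra2 _] := rc a2 H2 w H20 q2.
have {}final : (K `^ (- `|a1|) * H1 `^ a1) * (K `^ (- `|a2|) * H2 `^ a2) *
   (dk * 2^-1 * (m0 * H1 `^ k.+2%:R * (m0 * H2 `^ k.+2%:R))) <= C * N.
  apply: le_trans final; apply: ler_wpM2r.
    by rewrite !mulr_ge0 ?powR_ge0 ?(ltW m00) ?(ltW half0).
  by apply: ler_pM; rewrite ?mulr_ge0 ?powR_ge0.
have HE (H a b c : R) : 0 < H -> H `^ (a + b - c + k.+2%:R) =
    H `^ a * H `^ b * H `^ (- c) * H `^ k.+2%:R.
  move=> H0; have Hn : H != 0 by rewrite gt_eqF.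
  by rewrite !powRD ?Hn ?implybT.
have NE : N = B * H1 `^ ((k.+2%:R + al1) / p1).
  have Km : 0 <= K `^ `|al1| * m0 by rewrite mulr_ge0 ?powR_ge0 ?(ltW m00).
  rewrite /N -mulrACA [H1 `^ al1 * _]mulrC -powRD ?(gt_eqF H10) ?implybT//.
  by rewrite (powRM _ Km (powR_ge0 _ _)) -powRrM.
rewrite -mulrA [_^-1 * _]mulrC mulrA ler_pdivlMr// -mulrA -NE.
apply: le_trans final; rewrite le_eqVlt; apply/orP; left; apply/eqP.
rewrite !HE// /A /dk.
move: (H1 `^ a1) (H1 `^ b1) (H1 `^ - c1) (H1 `^ k.+2%:R) => x1 x2 x3 x4.
move: (H2 `^ a2) (H2 `^ b2) (H2 `^ - c2) (H2 `^ k.+2%:R) => y1 y2 y3 y4.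
move: (K `^ _) (K `^ _) (K `^ _) (K `^ _) (K `^ _) (K `^ _) (2^-1 : R) (m0).
by move=> *; ring.
Qed.

Lemma T_bounded_equalities k (p1 al1 al2 a1 a2 b1 b2 c1 c2 : R) : 1 < p1 ->
  @T_bounded R k.+1 p1 al1 al2 a1 a2 b1 b2 c1 c2 ->
  c1 = k.+2%:R + a1 + b1 - (k.+2%:R + al1) / p1 /\ c2 = k.+2%:R + a2 + b2.
Proof.
move=> p11 /(T_bounded_scaling p11)[C HC]; split.
  suff : a1 + b1 - c1 + k.+2%:R - (k.+2%:R + al1) / p1 = 0 by lra.
  apply: (@powR_bounded_eq0 _ _ C) => H H0.
  have := HC H 1 H0 ltr01; rewrite powR1 mulr1.
  by rewrite powRB ?(gt_eqF H0) ?implybT// ler_pdivrMr ?powR_gt0.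
suff : a2 + b2 - c2 + k.+2%:R = 0 by lra.
apply: (@powR_bounded_eq0 _ _ C) => H H0.
by have := HC 1 H ltr01 H0; rewrite !powR1 mul1r mulr1.
Qed.

End Equalities.

(** * Divergent test functions: the four inequalities *)

Section DivergentTests.
Variable R : realType.
Local Notation T k := (projT2 (Cspace R k.+1)).

(* [H j] is the height of the [j]-th box and [D j], comparable to [max 1 (H j)],
   the square of its width, so that [cabs (rho2 z u)] is of order [D j] when [z]
   stays in the unit box and [u] is in the [j]-th box. *)
Definition shells (H D : nat -> R) : Prop :=
  [/\ forall j, 0 < H j,
      forall j, [/\ 1 <= D j, D j <= 1 + H j & H j <= D j] &
      forall i j r, H i < r <= 4 * H i -> H j < r <= 4 * H j -> i = j].

Definition qbox k (H D : nat -> R) (j : nat) : set (T k) := @tbox R k (D j) (D j) (H j).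
Definition ubox k : set (T k) := @tbox R k 1 1 1.

Lemma measurable_ubox k : measurable (@ubox k).
Proof. exact: measurable_tbox. Qed.

Lemma ubox_measure k : lebC R k.+1 (@ubox k) = (3 * 4 ^+ k)%:E.
Proof.
rewrite /ubox tbox_measure//; congr (_%:E); rewrite !mulr1; exact: mulrC.
Qed.

Lemma ubox_neq0 k : lebC R k.+1 (@ubox k) <> 0%E.
Proof. by rewrite ubox_measure => -[] /eqP; rewrite gt_eqF// mulr_gt0 ?exprn_gt0. Qed.

Lemma ubox_sub_TB k : @ubox k `<=` @TB R k.+1.
Proof. by apply: tbox_sub_TB; exact: ler01. Qed.

Lemma qbox_measure k (H D : nat -> R) j : shells H D ->
  lebC R k.+1 (@qbox k H D j) = (3 * 4 ^+ k * (D j ^+ k.+1 * H j))%:E.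
Proof.
case=> H0 HD _; have [D1 _ _] := HD j; have D0 : 0 <= D j by apply: le_trans D1.
rewrite /qbox (tbox_measure _ D0 D0 (ltW (H0 j))); congr (_%:E).
rewrite (exprMn k 4) exprS; move: (4 ^+ k) (D j ^+ k) => x y; ring.
Qed.

Lemma qbox_bounds_aux (k H D a r : R) : 0 <= k -> 0 < H -> 1 <= D -> D <= 1 + H -> H <= D ->
  H < r <= 4 * H ->
  1 + H <= 2 * a -> 4 * a <= 8 * (1 + H) + 1 + D + 12 * k * D ->
  (H / (3 * k + 5) <= r <= (3 * k + 5) * H) /\
  (D / (3 * k + 5) <= a <= (3 * k + 5) * D).
Proof.
move=> k0 H0 D1 D2 D3 /andP[r1 r2] a1 a2.
have kH : 0 <= k * H by rewrite mulr_ge0// ltW.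
have kD : 0 <= k * D by rewrite mulr_ge0//; lra.
have K0 : 0 < 3 * k + 5 by lra.
split; apply/andP; split.
- by rewrite ler_pdivrMr// mulrDr; nra.
- by lra.
- by rewrite ler_pdivrMr// mulrDr; nra.
- by lra.
Qed.

Lemma qbox_bounds k (H D : nat -> R) j z u : shells H D -> @ubox k z -> qbox H D j u ->
  (H j / bconst R k <= rho u <= bconst R k * H j) /\
  (D j / bconst R k <= cabs (rho2 z u) <= bconst R k * D j).
Proof.
case=> H0 HD _ tz tu; have [D1 D2 D3] := HD j.
have D0 : 0 <= D j by apply: le_trans D1.
have [h1 h2] := tbox_cabs tz tu ler01 (ltW (H0 j)) D0 D1 (lexx _).
exact: qbox_bounds_aux (ler0n _ _) (H0 j) D1 D2 D3 (tbox_rho tu) h1 h2.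
Qed.

(** Boxes going to infinity, used against [a1 <= 0] and [a2 <= 0]. The ratio 4 between the extreme
    heights of a box makes the height intervals adjacent but disjoint. *)
Lemma dilation_shells : shells (fun j => 4 ^+ j) (fun j => 4 ^+ j).
Proof.
have p j : 1 <= 4 ^+ j :> R by rewrite exprn_ege1// ler1n.
have q j : 0 < 4 ^+ j :> R by rewrite exprn_gt0.
split => [//|j|i j r].
  by have := p j; split => //; lra.
have aux (a b : nat) : 4 ^+ a < r <= 4 * 4 ^+ a -> 4 ^+ b < r <= 4 * 4 ^+ b -> (b <= a)%N.
  move=> /andP[h1 h2] /andP[h3 h4]; rewrite leqNgt; apply/negP => ab.
  have : r <= 4 ^+ b by apply: (le_trans h2); rewrite -exprS ler_weXn2l// ler1n.
  by rewrite leNgt h3.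
by move=> h1 h2; apply/eqP; rewrite eqn_leq (aux j i)// (aux i j).
Qed.

(** Boxes of fixed width approaching the boundary. There the modulus of [rho2] stays of order 1, so
    these tests see [b1] and [b2] but not [c1] and [c2]. *)
Lemma boundary_shells : shells (fun j => 4^-1 ^+ j) (fun=> 1).
Proof.
have q j : 0 < 4^-1 ^+ j :> R by rewrite exprn_gt0// invr_gt0.
split => [//|j|i j r].
  split => //; first by rewrite lerDl ltW.
  by rewrite exprn_ile1 ?invr_ge0// invf_le1// ler1n.
have aux (a b : nat) : 4^-1 ^+ a < r <= 4 * 4^-1 ^+ a ->
    4^-1 ^+ b < r <= 4 * 4^-1 ^+ b -> (a <= b)%N.
  move=> /andP[h1 h2] /andP[h3 h4]; rewrite leqNgt; apply/negP => ba.
  have : 4 * 4^-1 ^+ a <= 4^-1 ^+ b :> R.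
    case: a ba {h1 h2} => // a; rewrite ltnS => ba.
    rewrite exprS mulrA divff ?pnatr_eq0// mul1r ler_wiXn2l// ?invr_ge0//.
    by rewrite invf_le1// ler1n.
  by move=> h; have := le_trans h2 h; rewrite leNgt h3.
by move=> h1 h2; apply/eqP; rewrite eqn_leq (aux i j)// (aux j i).
Qed.

Lemma qbox_disjoint k (H D : nat -> R) : shells H D -> trivIset setT (@qbox k H D).
Proof.
case=> _ _ dis i j _ _ [u [/tbox_rho h1 /tbox_rho h2]]; exact: dis h1 h2.
Qed.

(** For disjoint boxes at most one term of the series is nonzero at each point, so [fine] loses
    nothing. *)
Definition testf k (H D lam : nat -> R) (u : T k) : R :=
  fine (\sum_(0 <= j <oo) (lam j * \1_(@qbox k H D j) u)%:E)%E.

Lemma testf_in k (H D lam : nat -> R) j u : shells H D -> (forall i, 0 <= lam i) ->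
  @qbox k H D j u -> testf H D lam u = lam j.
Proof.
by move=> sh l0 q; rewrite /testf (eseries_disjoint (qbox_disjoint sh) l0 q).
Qed.

Lemma testf_out k (H D lam : nat -> R) u : (forall i, ~ @qbox k H D i u) ->
  testf H D lam u = 0.
Proof. by move=> q; rewrite /testf eseries_outside. Qed.

Lemma testf_cases k (H D : nat -> R) (u : T k) :
  (exists j, qbox H D j u) \/ (forall j, ~ qbox H D j u).
Proof.
have [h|h] := pselect (exists j, qbox H D j u); [by left|right => j q].
by apply: h; exists j.
Qed.

Lemma testf_range k (H D lam : nat -> R) (u : T k) : shells H D ->
  (forall i, 0 <= lam i <= 1) -> 0 <= testf H D lam u <= 1.
Proof.
move=> sh l01; have l0 i : 0 <= lam i by have /andP[] := l01 i.
have [[j q]|q] := testf_cases H D u; first by rewrite (testf_in sh l0 q).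
by rewrite (testf_out _ q) lexx ler01.
Qed.

Lemma testf_ge0 k (H D lam : nat -> R) (u : T k) : shells H D ->
  (forall i, 0 <= lam i) -> 0 <= testf H D lam u.
Proof.
move=> sh l0.
have [[j q]|q] := testf_cases H D u; first by rewrite (testf_in sh l0 q).
by rewrite (testf_out _ q).
Qed.

Lemma measurable_qbox_term k (H D c : nat -> R) (A : set (T k)) j :
  measurable_fun A (fun u => (c j * \1_(qbox H D j) u)%:E).
Proof.
apply: measurable_funTS; apply/measurable_EFinP; apply: measurable_funM.
  exact: measurable_cst.
by apply: measurable_indic; exact: measurable_tbox.
Qed.

Lemma measurable_testf k (H D lam : nat -> R) : (forall i, 0 <= lam i) ->
  measurable_fun setT (@testf k H D lam).
Proof.
move=> l0; apply: measurableT_comp; first exact: fine_measurable.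
apply: ge0_emeasurable_sum; first by move=> j u _ _; rewrite lee_fin mulr_ge0.
by move=> j _; exact: measurable_qbox_term.
Qed.

End DivergentTests.

(** * Norm and divergence of the test functions *)

Section Necessity.
Variable R : realType.
Local Notation T k := (projT2 (Cspace R k.+1)).
Local Open Scope complex_scope.

(** The weights [th j] keep the norm of each piece bounded; dividing them by [j.+1] leaves a Riemann
    series of exponent [p1 > 1]. *)
Lemma testf_weight k (p1 al1 : R) (H D th : nat -> R) : 1 < p1 -> shells H D ->
  (forall j, 0 <= th j) ->
  (forall j, th j `^ p1 * (H j `^ al1 * (D j ^+ k.+1 * H j)) <= 1) ->
  exists m : R, (\int[lebC R k.+1]_(u in @TB R k.+1)
    (@testf R k H D (fun j => th j / j.+1%:R) u `^ p1 * rho u `^ al1)%:E <= m%:E)%E.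
Proof.
move=> p11 sh th0 th1; pose lam j := th j / j.+1%:R.
have p0 : 0 < p1 by lra.
have l0 j : 0 <= lam j by rewrite divr_ge0.
have [H0 _ _] := sh.
pose K := bconst R k; have K1 : 1 <= K by exact: bconst_ge1.
pose c j := lam j `^ p1 * (K `^ `|al1| * H j `^ al1).
have c0 j : 0 <= c j by rewrite !mulr_ge0 ?powR_ge0.
pose A := K `^ `|al1| * (3 * 4 ^+ k).
have A0 : 0 <= A by rewrite !mulr_ge0 ?powR_ge0 ?exprn_ge0.
have mTB := @measurable_TB R k.
have mt : measurable_fun [set: T k] (fun u => (testf H D lam u `^ p1 * rho u `^ al1)%:E).
  apply/measurable_EFinP; apply: measurable_funM.
    by apply: (measurableT_comp (measurable_powR _)); exact: measurable_testf.
  by apply: (measurableT_comp (measurable_powR _)); exact: measurable_rho.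
have ineq := @le_integral_eseries _ _ R (lebC R k.+1) (@TB R k.+1)
   (fun u => (testf H D lam u `^ p1 * rho u `^ al1)%:E)
   (fun j u => (c j * \1_(qbox H D j) u)%:E) mTB (measurable_funTS mt).
have S : (\sum_(0 <= j <oo) (A * j.+1%:R `^ (- p1))%:E < +oo)%E.
  under eq_eseriesr do rewrite EFinM.
  rewrite nneseriesZl; last by move=> j _; rewrite lee_fin powR_ge0.
  by apply: lte_mul_pinfty; rewrite ?lee_fin// eseries_riemann.
suff lt : (\int[lebC R k.+1]_(u in @TB R k.+1)
    (testf H D lam u `^ p1 * rho u `^ al1)%:E <=
    \sum_(0 <= j <oo) (A * j.+1%:R `^ (- p1))%:E)%E.
  exists (fine (\sum_(0 <= j <oo) (A * j.+1%:R `^ (- p1))%:E)%E).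
  rewrite fineK// ge0_fin_numE//; apply: nneseries_ge0 => j _ _.
  by rewrite lee_fin mulr_ge0 ?powR_ge0.
apply: (le_trans (ineq _ _ _ _)).
- by move=> u _; rewrite lee_fin mulr_ge0 ?powR_ge0.
- by move=> j; exact: measurable_qbox_term.
- by move=> j u; rewrite lee_fin mulr_ge0.
- move=> u TBu; have [[j q]|q] := testf_cases H D u; last first.
    rewrite (testf_out _ q) powR0 ?gt_eqF// mul0r.
    by apply: nneseries_ge0 => j _ _; rewrite lee_fin mulr_ge0.
  rewrite (eseries_disjoint (qbox_disjoint sh) c0 q) (testf_in sh l0 q) lee_fin.
  apply: ler_wpM2l; first exact: powR_ge0.
  have h : H j / K <= rho u <= K * H j.
    have /andP[r1 r2] := tbox_rho q; have k0 := ler0n R k.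
    have Hj := H0 j; have kH : 0 <= k%:R * H j by rewrite mulr_ge0// ltW.
    apply/andP; split; last by rewrite /K /bconst; lra.
    apply: le_trans (ltW r1); rewrite ler_pdivrMr; last by lra.
    by rewrite ler_peMr// ltW.
  by have /andP[] := powR_comparable al1 K1 (H0 j) h.
apply: lee_nneseries => [j _ _|j _].
  by apply: integral_ge0 => u _; rewrite lee_fin mulr_ge0.
have mq : (lebC R k.+1 (qbox H D j) <= (3 * 4 ^+ k * (D j ^+ k.+1 * H j))%:E)%E.
  by rewrite qbox_measure.
apply: (le_trans (integral_scaled_indic mTB (measurable_tbox _ _ _) (c0 j) mq)).
rewrite lee_fin /c /lam powRM ?invr_ge0//.
have -> : (j.+1%:R^-1 : R) `^ p1 = j.+1%:R `^ (- p1).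
  by rewrite -powR_inv1 ?ler0n// -powRrM mulN1r.
rewrite [leLHS](_ : _ = A * j.+1%:R `^ (- p1) *
   (th j `^ p1 * (H j `^ al1 * (D j ^+ k.+1 * H j)))).
  by apply: ler_piMr => //; rewrite mulr_ge0 ?powR_ge0.
rewrite /A; move: (th j `^ p1) (j.+1%:R `^ _) (K `^ _) (H j `^ _) (4 ^+ k) (D j ^+ k.+1).
by move=> *; ring.
Qed.

(** With weight [th j] each box contributes at least a fixed positive amount; after division by
    [j.+1] the harmonic series is a lower bound. *)
Lemma testf_diverge k (b c : R) (H D th : nat -> R) : shells H D ->
  (forall j, 0 <= th j) ->
  (forall j, 1 <= th j * (H j `^ b * D j `^ (- c) * (D j ^+ k.+1 * H j))) ->
  forall z, @ubox R k z ->
  (\int[lebC R k.+1]_(u in @TB R k.+1)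
    (kern b c z u * @testf R k H D (fun j => th j / j.+1%:R) u)%:E = +oo)%E.
Proof.
move=> sh th0 th1 z uz; pose lam j := th j / j.+1%:R.
have l0 j : 0 <= lam j by rewrite divr_ge0.
have [H0 HD _] := sh.
have D0 j : 0 < D j by have [d1 _ _] := HD j; apply: lt_le_trans d1.
pose K := bconst R k; have K1 : 1 <= K by exact: bconst_ge1.
have K0 : 0 < K by lra.
pose kap := K `^ (- `|b|) * K `^ (- `|c|).
have kap0 : 0 < kap by rewrite mulr_gt0 ?powR_gt0.
pose m j := kap * (H j `^ b * D j `^ (- c)) * lam j.
have m0 j : 0 <= m j by rewrite !mulr_ge0 ?powR_ge0.
have mTB := @measurable_TB R k.
apply/eqP; rewrite -leye_eq.
have A0 : 0 < kap * (3 * 4 ^+ k) by rewrite !mulr_gt0 ?exprn_gt0 ?powR_gt0.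
rewrite -(eseries_harmonic A0).
apply: (@le_trans _ _ (\int[lebC R k.+1]_(u in @TB R k.+1)
   \sum_(0 <= j <oo) (m j * \1_(qbox H D j) u)%:E)%E); last first.
  apply: ge0_le_integral => //.
  - by move=> u _; apply: nneseries_ge0 => j _ _; rewrite lee_fin mulr_ge0.
  - apply: ge0_emeasurable_sum; first by move=> j u _ _; rewrite lee_fin mulr_ge0.
    by move=> j _; exact: measurable_qbox_term.
  - apply/measurable_EFinP; apply: measurable_funTS; apply: measurable_funM.
      exact: measurable_kern.
    exact: measurable_testf.
  move=> u _; have [[j q]|q] := testf_cases H D u; last first.
    by rewrite (testf_out _ q) (eseries_outside _ q) mulr0.
  rewrite (eseries_disjoint (qbox_disjoint sh) m0 q) (testf_in sh l0 q) lee_fin.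
  apply: ler_wpM2r => //; have [g1 g2] := qbox_bounds sh uz q.
  exact: kern_lower.
rewrite integral_nneseries//; last 2 first.
- by move=> j; exact: measurable_qbox_term.
- by move=> j u _; rewrite lee_fin mulr_ge0.
apply: lee_nneseries => [j _ _|j _]; first by rewrite lee_fin divr_ge0 ?(ltW A0).
have mq : measurable (qbox H D j : set (T k)) by exact: measurable_tbox.
under eq_integral do rewrite EFinM.
rewrite (@ge0_integralZl_EFin _ _ _ _ _ mTB _ _ _ _ (m0 j)); last 2 first.
- by move=> u _; rewrite lee_fin.
- by apply/measurable_EFinP; apply: measurable_funTS; exact: measurable_indic.
rewrite integral_indic// (_ : qbox H D j `&` _ = qbox H D j); last first.
  by apply/setIidl; apply: tbox_sub_TB; exact: ltW.
rewrite [X in (_ * X)%E](qbox_measure k j sh) -EFinM lee_fin /m /lam.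
rewrite [leRHS](_ : _ = kap * (3 * 4 ^+ k) / j.+1%:R *
  (th j * (H j `^ b * D j `^ (- c) * (D j ^+ k.+1 * H j)))).
  by apply: ler_peMr => //; rewrite divr_ge0// ltW.
move: (th j) (j.+1%:R^-1) (kap) (H j `^ b) (D j `^ _) (4 ^+ k) (D j ^+ k.+1).
by move=> *; ring.
Qed.

Lemma mulr_swap4 (a b c d : R) : a * b * (c * d) = b * d * (a * c).
Proof. by ring. Qed.

(** Integrability of the real and imaginary parts gives that of the modulus, which is a product of
    functions of one variable each, and Tonelli splits the integral. *)
Lemma T_bounded_product k (p1 al1 al2 a1 a2 b1 b2 c1 c2 m : R) (f1 f2 : T k -> R) :
  1 < p1 -> @T_bounded R k.+1 p1 al1 al2 a1 a2 b1 b2 c1 c2 ->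
  measurable_fun setT f1 -> measurable_fun setT f2 ->
  (forall u, 0 <= f1 u) -> (forall u, 0 <= f2 u <= 1) ->
  (\int[lebC R k.+1]_(u in @TB R k.+1) (f1 u `^ p1 * rho u `^ al1)%:E <= m%:E)%E ->
  exists z w, [/\ @ubox R k z, @ubox R k w &
   ((\int[lebC R k.+1]_(u in @TB R k.+1) (kern b1 c1 z u * f1 u)%:E) *
    (\int[lebC R k.+1]_(u in @TB R k.+1) (kern b2 c2 w u * f2 u)%:E) < +oo)%E].
Proof.
move=> p11 /bounded_point[C HC] mf1 mf2 f10 f21 hm.
have p0 : 0 < p1 by lra.
have f20 u : 0 <= f2 u by have /andP[] := f21 u.
have nrm := mixed_norm_prodtest al2 p0 mf1 f10 f21 hm.
have mf := prodtest_cmeasurable mf1 mf2.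
have [z [w [uz uw [iRe iIm] _]]] := HC _ _ _ _ mf nrm (@measurable_ubox R k)
  (@measurable_ubox R k) (@ubox_neq0 R k) (@ubox_neq0 R k) (@ubox_sub_TB R k) (@ubox_sub_TB R k).
exists z, w; split; [exact: uz|exact: uw|]; clear HC nrm.
have mTB := @measurable_TB R k; have mD := @measurable_TBX R k.
have cE ue : cabs (Tkernel b1 b2 c1 c2 (prodtest f1 f2) z w ue) =
    dkern b1 b2 c1 c2 z w ue * (f1 ue.1 * f2 ue.2).
  by rewrite cabs_Tkernel cabs_real// mulr_ge0.
move: iRe iIm cE; move: (Tkernel _ _ _ _ _ _ _) => g /= iRe iIm cE.
have mF : measurable_fun [set: (T k * T k)%type]
    (fun ue => (dkern b1 b2 c1 c2 z w ue * (f1 ue.1 * f2 ue.2))%:E).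
  apply/measurable_EFinP; apply: measurable_funM; first exact: measurable_dkern.
  by have [] := prodtest_cmeasurable mf1 mf2.
have F0 ue : (0 <= (dkern b1 b2 c1 c2 z w ue * (f1 ue.1 * f2 ue.2))%:E)%E.
  by rewrite lee_fin; apply: mulr_ge0; [exact: dkern_ge0|exact: mulr_ge0].
have fin : (\int[@dV2 R k.+1]_(ue in @TB R k.+1 `*` @TB R k.+1)
    (dkern b1 b2 c1 c2 z w ue * (f1 ue.1 * f2 ue.2))%:E < +oo)%E.
  have iS := integrableD mD (integrable_abse iRe) (integrable_abse iIm).
  apply: (le_lt_trans _ (integrable_lty mD iS)).
  apply: ge0_le_integral.
  - exact: mD.
  - by move=> ue _; exact: F0.
  - exact: measurable_funTS.
  - exact: measurable_int iS.
  move=> ue _; rewrite -cE /= -EFinD lee_fin; exact: cabs_le.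
move: fin; rewrite /dV2 (tonelli_setX _ _ mTB mTB mF F0).
set I1 := (\int[lebC R k.+1]_(u in @TB R k.+1) (kern b1 c1 z u * f1 u)%:E)%E.
have I10 : (0 <= I1)%E.
  by apply: integral_ge0 => u _; rewrite lee_fin mulr_ge0 ?kern_ge0.
have mk b c v (f : T k -> R) : measurable_fun setT f ->
    measurable_fun (@TB R k.+1 : set (T k)) (fun u => (kern b c v u * f u)%:E).
  move=> mh; apply: measurable_funTS; apply/measurable_EFinP; apply: measurable_funM => //.
  exact: measurable_kern.
rewrite (_ : (\int[lebC R k.+1]_(y in @TB R k.+1) _)%E =
  (\int[lebC R k.+1]_(y in @TB R k.+1) (I1 * (kern b2 c2 w y * f2 y)%:E))%E).
  rewrite ge0_integralZl//; first exact: mk.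
  by move=> u _; rewrite lee_fin mulr_ge0 ?kern_ge0.
apply: eq_integral => y _; rewrite muleC.
have ky : 0 <= kern b2 c2 w y * f2 y by rewrite mulr_ge0 ?kern_ge0.
rewrite -(@ge0_integralZl_EFin _ _ _ _ _ mTB _ _ (mk b1 c1 z f1 mf1) _ ky).
  by apply: eq_integral => u _; rewrite -EFinM /dkern /=; congr (_%:E); exact: mulr_swap4.
by move=> u _; rewrite lee_fin mulr_ge0 ?kern_ge0.
Qed.

(** In [\bar R] zero times infinity is zero, so divergence of one factor contradicts
    [T_bounded_product] only when the other factor is positive. *)
Lemma ubox_pairing_gt0 k (b c : R) z : @ubox R k z ->
  (0 < \int[lebC R k.+1]_(u in @TB R k.+1) (kern b c z u * \1_(@ubox R k) u)%:E)%E.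
Proof.
move=> uz; pose K := bconst R k; have K1 : 1 <= K by exact: bconst_ge1.
have K0 : 0 < K by lra.
pose kap := K `^ (- `|b|) * K `^ (- `|c|) * (1 `^ b * 1 `^ (- c)).
have kap0 : 0 < kap by rewrite !mulr_gt0 ?powR_gt0.
have mTB := @measurable_TB R k.
have mu := @measurable_ubox R k.
apply: (@lt_le_trans _ _ (\int[lebC R k.+1]_(u in @TB R k.+1) (kap * \1_(@ubox R k) u)%:E)%E).
  under eq_integral do rewrite EFinM.
  rewrite (@ge0_integralZl_EFin _ _ _ _ _ mTB _ _ _ _ (ltW kap0)); last 2 first.
  - by move=> u _; rewrite lee_fin.
  - by apply/measurable_EFinP; apply: measurable_funTS; exact: measurable_indic.
  rewrite integral_indic// (_ : @ubox R k `&` _ = @ubox R k); last first.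
    by apply/setIidl; exact: ubox_sub_TB.
  by rewrite [X in (_ * X)%E]ubox_measure -EFinM lte_fin; apply: mulr_gt0 => //; rewrite mulr_gt0 ?exprn_gt0.
apply: ge0_le_integral => //.
- by move=> u _; rewrite lee_fin mulr_ge0// ltW.
- apply: measurable_funTS; apply/measurable_EFinP.
  by apply: measurable_funM; [exact: measurable_cst|exact: measurable_indic].
- apply: measurable_funTS; apply/measurable_EFinP.
  by apply: measurable_funM; [exact: measurable_kern|exact: measurable_indic].
move=> u _; rewrite lee_fin indicE; have [|_] := boolP (u \in @ubox R k); last by rewrite !mulr0.
(* The unit box is the box of index 0 of the dilation shells, since [4 ^+ 0 = 1]. *)
rewrite inE !mulr1 => uu; have q : @qbox R k (fun j => 4 ^+ j) (fun j => 4 ^+ j) 0 u by [].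
have [] := qbox_bounds (dilation_shells R) uz q; rewrite /= expr0 => g1 g2.
exact: kern_lower K1 ltr01 ltr01 g1 g2.
Qed.

Lemma T_bounded_first_test k (p1 al1 al2 a1 a2 b1 b2 c1 c2 : R) (H D th : nat -> R) :
  1 < p1 -> @T_bounded R k.+1 p1 al1 al2 a1 a2 b1 b2 c1 c2 -> shells H D ->
  (forall j, 0 <= th j) ->
  (forall j, th j `^ p1 * (H j `^ al1 * (D j ^+ k.+1 * H j)) <= 1) ->
  ~ (forall j, 1 <= th j * (H j `^ b1 * D j `^ (- c1) * (D j ^+ k.+1 * H j))).
Proof.
move=> p11 hT sh th0 th1 th2.
have l0 j : 0 <= th j / j.+1%:R by rewrite divr_ge0.
have [m hm] := testf_weight p11 sh th0 th1.
have i01 u : 0 <= (\1_(@ubox R k) u : R) <= 1.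
  by rewrite indicE; case: (_ \in _); rewrite /= ?lexx ?ler01.
have mi k' : measurable_fun setT (\1_(@ubox R k') : T k' -> R).
  by apply: measurable_indic; exact: measurable_ubox.
have [z [w [uz uw]]] := T_bounded_product p11 hT (measurable_testf (k := k) H D l0)
  (mi k) (fun u => testf_ge0 u sh l0) i01 hm.
by rewrite (testf_diverge sh th0 th2 uz) gt0_mulye ?ltxx// ubox_pairing_gt0.
Qed.

Lemma T_bounded_second_test k (p1 al1 al2 a1 a2 b1 b2 c1 c2 : R) (H D : nat -> R) :
  1 < p1 -> @T_bounded R k.+1 p1 al1 al2 a1 a2 b1 b2 c1 c2 -> shells H D ->
  ~ (forall j, 1 <= H j `^ b2 * D j `^ (- c2) * (D j ^+ k.+1 * H j)).
Proof.
move=> p11 hT sh th2; have p0 : 0 < p1 by lra.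
(* The second variable carries a supremum norm, so the bounded weights [1 / j.+1] are admissible as
   they are. *)
pose th (j : nat) : R := 1; have th0 j : 0 <= th j by exact: ler01.
have l01 j : 0 <= th j / j.+1%:R <= 1.
  by rewrite divr_ge0//= /th mul1r invf_le1 ?ler1n ?ltr0n.
have l0 j : 0 <= th j / j.+1%:R by have /andP[] := l01 j.
pose K := bconst R k; have K1 : 1 <= K by exact: bconst_ge1.
have um : (lebC R k.+1 (@ubox R k) <= (3 * 4 ^+ k)%:E)%E by rewrite ubox_measure.
have cc0 : 0 <= K `^ `|al1| * 1 `^ al1 by rewrite mulr_ge0 ?powR_ge0.
have hm := @indic_weight_le R k p1 al1 (K `^ `|al1| * 1 `^ al1) _ (@ubox R k) p0 (measurable_ubox (k := k)) cc0 _ um.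
have {}hm := hm _.
have i0 u : 0 <= (\1_(@ubox R k) u : R) by rewrite indicE.
have wt u : @ubox R k u -> rho u `^ al1 <= K `^ `|al1| * 1 `^ al1.
  move=> uu; have q : @qbox R k (fun j => 4 ^+ j) (fun j => 4 ^+ j) 0 u by [].
  have [] := qbox_bounds (dilation_shells R) uu q; rewrite /= expr0 => g1 _.
  by have /andP[] := powR_comparable al1 K1 ltr01 g1.
have mi k' : measurable_fun setT (\1_(@ubox R k') : T k' -> R).
  by apply: measurable_indic; exact: measurable_ubox.
have [z [w [uz uw]]] := T_bounded_product p11 hT
  (mi k) (measurable_testf (k := k) H D l0) i0
  (fun u => testf_range u sh l01) (hm wt).
have th2' j : 1 <= th j * (H j `^ b2 * D j `^ (- c2) * (D j ^+ k.+1 * H j)).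
  by rewrite mul1r.
by rewrite (testf_diverge sh th0 th2' uw) gt0_muley ?ltxx// ubox_pairing_gt0.
Qed.

End Necessity.

(** * The four inequalities and the equivalence *)

Section Final.
Variable R : realType.

Lemma powR_ge1 (h e : R) : 1 <= h -> 0 <= e -> 1 <= h `^ e.
Proof. by move=> h1 e0; rewrite -(powRr0 h) ler_powR. Qed.

Lemma powR_ge1_inv (h e : R) : 0 < h -> h <= 1 -> e <= 0 -> 1 <= h `^ e.
Proof. by move=> h0 h1 e0; rewrite -(powRr0 h) ger_powR// h0. Qed.

Lemma powR_collect k (h b c : R) : 0 < h ->
  h `^ b * h `^ (- c) * (h ^+ k.+1 * h) = h `^ (b - c + k.+2%:R).
Proof.
move=> h0; have hN : h != 0 by rewrite gt_eqF.
by rewrite -exprSr -(powR_mulrn _ (ltW h0)) -!powRD ?hN ?implybT.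
Qed.

Lemma T_bounded_necessary k (p1 al1 al2 a1 a2 b1 b2 c1 c2 : R) : 1 < p1 ->
  @T_bounded R k.+1 p1 al1 al2 a1 a2 b1 b2 c1 c2 ->
  [/\ 0 < a1, 0 < a2, al1 + 1 < p1 * (b1 + 1) & -1 < b2].
Proof.
move=> p11 hT; have [c1E c2E] := T_bounded_equalities p11 hT.
have p0 : 0 < p1 by lra.
have pN : p1 != 0 by rewrite gt_eqF.
have g1 j : 1 <= 4 ^+ j :> R by rewrite exprn_ege1// ler1n.
have g0 j : 0 < 4 ^+ j :> R by rewrite exprn_gt0.
have s0 j : 0 < 4^-1 ^+ j :> R by rewrite exprn_gt0// invr_gt0.
have s1 j : 4^-1 ^+ j <= 1 :> R.
  by rewrite exprn_ile1 ?invr_ge0// invf_le1// ler1n.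
split; rewrite ltNge; apply/negP => h.
(* A box of height and squared width [4 ^ j] has weighted volume of order [(4 ^ j) ^ (n + 1 + al1)];
   this [G] normalises it. By the formula for [c1] the remaining exponent is [- a1]. *)
- pose G := (k.+2%:R + al1) / p1.
  apply: (T_bounded_first_test (th := fun j => (4 ^+ j) `^ (- G)) p11 hT (dilation_shells R)) => j.
  + exact: powR_ge0.
  + have -> : (4 ^+ j : R) `^ al1 * ((4 ^+ j) ^+ k.+1 * 4 ^+ j) = (4 ^+ j) `^ (k.+2%:R + al1).
      by have := powR_collect k al1 0 (g0 j); rewrite oppr0 powRr0 mulr1 addr0 (addrC al1).
    rewrite -powRrM -powRD ?(gt_eqF (g0 j)) ?implybT//.
    by rewrite mulNr /G divfK// addNr powRr0.
  + rewrite powR_collect// -powRD ?(gt_eqF (g0 j)) ?implybT//.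
    apply: powR_ge1 => //; rewrite (_ : _ + _ = - a1) ?oppr_ge0//.
    by rewrite c1E /G; ring.
- apply: (T_bounded_second_test p11 hT (dilation_shells R)) => j.
  rewrite powR_collect//; apply: powR_ge1 => //; rewrite (_ : _ + _ = - a2) ?oppr_ge0//.
  by rewrite c2E; ring.
(* Near the boundary the width is fixed and the volume is only of order [H], so [al1 + 1] takes the
   place of [n + 1 + al1]. *)
- pose G := (al1 + 1) / p1.
  apply: (T_bounded_first_test (th := fun j => (4^-1 ^+ j) `^ (- G)) p11 hT (boundary_shells R)) => j.
  + exact: powR_ge0.
  + rewrite expr1n mul1r -powRrM mulrA -powRD ?(gt_eqF (s0 j)) ?implybT//.
    rewrite -[X in _ * X](powRr1 (ltW (s0 j))) -powRD ?(gt_eqF (s0 j)) ?implybT//.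
    rewrite (_ : _ + 1 = 0) ?powRr0// mulNr /G divfK//; ring.
  + rewrite powR1 mulr1 expr1n mul1r.
    rewrite -[X in _ * (_ * X)](powRr1 (ltW (s0 j))) -!powRD ?(gt_eqF (s0 j)) ?implybT//.
    apply: powR_ge1_inv => //; rewrite addrC subr_le0 /G ler_pdivlMr// mulrC.
    exact: h.
- apply: (T_bounded_second_test p11 hT (boundary_shells R)) => j.
  rewrite powR1 mulr1 expr1n mul1r.
  rewrite -[X in _ * X](powRr1 (ltW (s0 j))) -powRD ?(gt_eqF (s0 j)) ?implybT//.
  by apply: powR_ge1_inv => //; lra.
Qed.

Lemma T_bounded_conditions k (p1 al1 al2 a1 a2 b1 b2 c1 c2 : R) : 1 < p1 ->
  @T_bounded R k.+1 p1 al1 al2 a1 a2 b1 b2 c1 c2 ->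
  0 < a1 /\ 0 < a2 /\ al1 + 1 < p1 * (b1 + 1) /\ -1 < b2 /\
  c1 = k.+1%:R + 1 + a1 + b1 - (k.+1%:R + 1 + al1) / p1 /\
  c2 = k.+1%:R + 1 + a2 + b2.
Proof.
move=> p11 hT; have [c1E c2E] := T_bounded_equalities p11 hT.
have [h1 h2 h3 h4] := T_bounded_necessary p11 hT.
by rewrite (natr1 k.+1) -c1E -c2E.
Qed.

Lemma conditions_S_bounded k (p1 al1 al2 a1 a2 b1 b2 c1 c2 : R) : 1 < p1 ->
  0 < a1 /\ 0 < a2 /\ al1 + 1 < p1 * (b1 + 1) /\ -1 < b2 /\
  c1 = k.+1%:R + 1 + a1 + b1 - (k.+1%:R + 1 + al1) / p1 /\
  c2 = k.+1%:R + 1 + a2 + b2 ->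
  @S_bounded R k.+1 p1 al1 al2 a1 a2 b1 b2 c1 c2.
Proof.
move=> p11 [h1 [h2 [h3 [h4 [h5 h6]]]]]; rewrite (natr1 k.+1) in h5 h6.
exact: S_bounded_sufficient h1 h2 h3 h4 h5 h6.
Qed.

End Final.

Theorem theorem6p13 (R : realType) (n : nat)
    (p1 al1 al2 a1 a2 b1 b2 c1 c2 : R) :
  (0 < n)%N -> 1 < p1 -> -1 < al1 -> -1 < al2 ->
  (@S_bounded R n p1 al1 al2 a1 a2 b1 b2 c1 c2 <->
   @T_bounded R n p1 al1 al2 a1 a2 b1 b2 c1 c2) /\
  (@T_bounded R n p1 al1 al2 a1 a2 b1 b2 c1 c2 <->
   (0 < a1 /\ 0 < a2 /\ al1 + 1 < p1 * (b1 + 1) /\ -1 < b2 /\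
    c1 = n%:R + 1 + a1 + b1 - (n%:R + 1 + al1) / p1 /\
    c2 = n%:R + 1 + a2 + b2)).
Proof.
case: n => [//|k] _ p11 _ _; split; split => h.
- exact: (S_bounded_T_bounded h).
(* The way back from [T] to [S] passes through the conditions. *)
- exact: (conditions_S_bounded _ p11 (T_bounded_conditions p11 h)).
- exact: (T_bounded_conditions p11 h).
- exact: (S_bounded_T_bounded (conditions_S_bounded _ p11 h)).
Qed.
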